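(* Suppose $f:(M^{m+k},\mathcal F^k,g)\to(N^{n+l},\widetilde{\mathcal F}^l,\widetilde g)$ is a transversally harmonic map between two Riemannian foliations. Then $$(\operatorname{div}S_{\mathcal H,\widetilde{\mathcal H}}(f))(X)=0$$ for every smooth vector field $X$ on $M$.
   Context: A foliation $\mathcal F^k$ on a smooth manifold $M^{m+k}$ is given by an integrable rank-$k$ distribution $\mathcal V\subset TM$. Given a Riemannian metric $g$, put $\mathcal H=\mathcal V^\perp$ with orthogonal projections $\pi_{\mathcal H},\pi_{\mathcal V}$ and $g_{\mathcal H}=g(\pi_{\mathcal H}\cdot,\pi_{\mathcal H}\cdot)$. $(M,\mathcal F,g)$ is a Riemannian foliation if $\mathcal L_Ug_{\mathcal H}=0$ for every section $U$ of $\mathcal V$. Let $\nabla$ be the Levi-Civita connection of $g$. For $X,Y$ horizontal, $U$ vertical: $\mathcal W_XU=-\pi_{\mathcal V}(\nabla_UX)$, $\mathcal T_XY=\pi_{\mathcal V}(\nabla_XY)=\frac12\pi_{\mathcal V}([X,Y])$, extended to $TM$ by first projecting the arguments ($\mathcal W_XY=\mathcal W_{\pi_{\mathcal H}X}\pi_{\mathcal V}Y$, $\mathcal T_XY=\mathcal T_{\pi_{\mathcal H}X}\pi_{\mathcal H}Y$); $\mathcal T^*$ is defined by $g(\mathcal T_X^*Y,Z)=g(Y,\mathcal T_XZ)$. Objects on $N$ carry a tilde. For smooth $f:M\to N$: $df_{\mathcal H,\widetilde{\mathcal H}}=\pi_{\widetilde{\mathcal H}}\circ df\circ\pi_{\mathcal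 H}$, $df_{\mathcal H,\widetilde{\mathcal V}}=\pi_{\widetilde{\mathcal V}}\circ df\circ\pi_{\mathcal H}$; $|df_{\mathcal H,\widetilde{\mathcal H}}|^2=\sum_i|df_{\mathcal H,\widetilde{\mathcal H}}(e_i)|^2$ for a local orthonormal frame $\{e_i\}_{i=1}^m$ of $\mathcal H$. With $\widetilde\nabla$ also the pull-back connection on $f^{-1}TN$, $\beta_{\mathcal H,\widetilde{\mathcal H}}(X,Y)=\widetilde\nabla_X(df_{\mathcal H,\widetilde{\mathcal H}}(Y))-df_{\mathcal H,\widetilde{\mathcal H}}(\nabla_XY)$. The map $f$ is horizontally harmonic if it is a critical point of $E_{\mathcal H,\widetilde{\mathcal H}}(f)=\frac12\int_M|df_{\mathcal H,\widetilde{\mathcal H}}|^2dV_g$, that is, $\operatorname{tr}_g\beta_{\mathcal H,\widetilde{\mathcal H}}+\sum_i\big(\widetilde{\mathcal T}^*_{df_{\mathcal H,\widetilde{\mathcal H}}(e_i)}df_{\mathcal H,\widetilde{\mathcal V}}(e_i)+\widetilde{\mathcal W}_{df_{\mathcal H,\widetilde{\mathcal H}}(e_i)}df_{\mathcal H,\widetilde{\mathcal V}}(e_i)\big)=0$. It is foliated if $df(\mathcal V)\subset\widetilde{\mathcal V}$, and transversally harmonic if it is horizontally harmonic and foliated. The stress-energy tensor is $S_{\mathcal H,\widetilde{\mathcal H}}(f)(X,Y)=\frac12|df_{\mathcal H,\widetilde{\mathcal H}}|^2g(X,Y)-\langle df_{\mathcal H,\widetilde{\mathcal H}}(X),df_{\mathcal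 H,\widetilde{\mathcal H}}(Y)\rangle$, and $(\operatorname{div}S)(X)=\sum_A(\nabla_{e_A}S)(e_A,X)$ for a local orthonormal frame $\{e_A\}$ of $TM$. *)

(* Defs.v *)
(* Geometric objects on a manifold are given by their components in the charts
   of an atlas, subject to the usual change-of-coordinates laws.  Tangent
   vectors are row vectors and linear maps act on the right; in particular
   'd f x v = v *m 'J f x.  A subspace of a tangent space is the row space of a
   matrix (scope %MS). *)
From HB Require Import structures.
From mathcomp Require Import all_boot all_order all_algebra.
From mathcomp Require Import all_classical all_reals all_analysis.
Set Implicit Arguments.
Unset Strict Implicit.
Unset Printing Implicit Defensive.
Import Order.TTheory GRing.Theory Num.Theory.
Import numFieldNormedType.Exports.
Local Open Scope classical_set_scope.
Local Open Scope ring_scope.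

Section smoothness.
Context {R : realType} {d : nat}.

Definition partial {V : normedModType R} (i : 'I_d) (f : 'rV[R]_d -> V)
  (x : 'rV[R]_d) : V := 'D_(delta_mx 0 i) f x.

Fixpoint Ck_on {V : normedModType R} (r : nat) (A : set 'rV[R]_d)
    (f : 'rV[R]_d -> V) : Prop :=
  match r with
  | 0%N => forall x, A x -> {for x, continuous f}
  | r'.+1 => (forall x, A x -> differentiable f x) /\
             (forall i, Ck_on r' A (partial i f))
  end.

(* Meant for open A only. *)
Definition smooth_on {V : normedModType R} (A : set 'rV[R]_d)
  (f : 'rV[R]_d -> V) : Prop := forall r, Ck_on r A f.

End smoothness.

(* Coordinate expression of a metric and of a distribution. *)
Record geom (R : realType) (d : nat) := Geom {
  gram : 'rV[R]_d -> 'M[R]_d ;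
  vert : 'rV[R]_d -> 'M[R]_d }.

Section coordinate_geometry.
Context {R : realType} {d : nat}.
Local Notation E := 'rV[R]_d.
Implicit Types (a : geom R d) (x u v w : E) (X Y Z U : E -> E).

Definition inner (G : 'M[R]_d) u v : R := (u *m G *m v^T) 0 0.

(* Gamma_ij^k = 1/2 g^{kl} (d_i g_jl + d_j g_il - d_l g_ij), the Levi-Civita
   connection of gram a in the chart. *)
Definition christoffel a x (i j k : 'I_d) : R :=
  2^-1 * \sum_l (partial i (fun z => gram a z j l : R) x
                 + partial j (fun z => gram a z i l : R) x
                 - partial l (fun z => gram a z i j : R) x)
                * invmx (gram a x) l k.

Definition chr a x u v : E :=
  \row_k \sum_i \sum_j u 0 i * v 0 j * christoffel a x i j k.

Definition nabla a X Y x : E := 'D_(X x) Y x + chr a x (X x) (Y x).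

Definition bracket X Y x : E := 'D_(X x) Y x - 'D_(Y x) X x.

(* The row space of hor a x is the g-orthogonal complement of that of
   vert a x: u is in it iff u *m gram a x *m (vert a x)^T = 0. *)
Definition hor a x : 'M[R]_d := kermx (gram a x *m (vert a x)^T).

Definition piV a x : 'M[R]_d := proj_mx (vert a x) (hor a x).
Definition piH a x : 'M[R]_d := proj_mx (hor a x) (vert a x).

Definition gH a x u v : R := inner (gram a x) (u *m piH a x) (v *m piH a x).

(* (L_U g_H)(X, Y) *)
Definition lie_gH a U X Y x : R :=
  'D_(U x) (fun z => gH a z (X z) (Y z) : R) x
  - gH a x (bracket U X x) (Y x) - gH a x (X x) (bracket U Y x).

(* W and T are tensorial, so their values on tangent vectors at x are computed
   on extensions with constant components in the chart. *)
Definition Wtens a x u w : E :=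
  - (nabla a (fun=> w *m piV a x) (fun z => u *m piH a z) x *m piV a x).

Definition Ttens a x u v : E :=
  nabla a (fun=> u *m piH a x) (fun z => v *m piH a z) x *m piV a x.

(* T*_u w is the vector representing the covector z |-> g(w, T_u z). *)
Definition Tadj a x u w : E :=
  (\row_j inner (gram a x) w (Ttens a x u (delta_mx 0 j))) *m invmx (gram a x).

Definition orthonormal_frame a (A : set E) (q : nat) (e : 'I_q -> E -> E) :=
  (forall i, smooth_on A (e i)) /\
  (forall x, A x -> forall i j,
     inner (gram a x) (e i x) (e j x) = (i == j)%:R).

Definition horizontal_frame a (A : set E) (q : nat) (e : 'I_q -> E -> E) :=
  orthonormal_frame a A e /\
  (forall x, A x -> forall i, (e i x <= hor a x)%MS).

End coordinate_geometry.

Section coordinate_maps.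
Context {R : realType} {d d' : nat}.
Variables (a : geom R d) (b : geom R d') (f : 'rV[R]_d -> 'rV[R]_d').
Local Notation E := 'rV[R]_d.
Local Notation E' := 'rV[R]_d'.
Implicit Types (x u v : E) (X Y Z : E -> E).

Definition dHH x u : E' := 'd f x (u *m piH a x) *m piH b (f x).
Definition dHV x u : E' := 'd f x (u *m piH a x) *m piV b (f x).

(* The pull-back connection, acting on a section s of the pull-back of the
   tangent bundle of the target. *)
Definition nabla_pull X (s : E -> E') x : E' :=
  'D_(X x) s x + chr b (f x) ('d f x (X x)) (s x).

Definition betaHH X Y x : E' :=
  nabla_pull X (fun z => dHH z (Y z)) x - dHH x (nabla a X Y x).

(* eT is an orthonormal frame of the tangent bundle, eH one of the horizontal
   bundle. *)
Definition tensionHH (m : nat) (eT : 'I_d -> E -> E) (eH : 'I_m -> E -> E) x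
    : E' :=
  \sum_A betaHH (eT A) (eT A) x
  + \sum_i (Tadj b (f x) (dHH x (eH i x)) (dHV x (eH i x))
            + Wtens b (f x) (dHH x (eH i x)) (dHV x (eH i x))).

Definition norm2_dHH (m : nat) (eH : 'I_m -> E -> E) x : R :=
  \sum_i inner (gram b (f x)) (dHH x (eH i x)) (dHH x (eH i x)).

Definition stressHH (m : nat) (eH : 'I_m -> E -> E) X Y x : R :=
  2^-1 * norm2_dHH eH x * inner (gram a x) (X x) (Y x)
  - inner (gram b (f x)) (dHH x (X x)) (dHH x (Y x)).

Definition nabla_stressHH (m : nat) (eH : 'I_m -> E -> E) Z X Y x : R :=
  'D_(Z x) (stressHH eH X Y : E -> R) x
  - stressHH eH (nabla a Z X) Y x - stressHH eH X (nabla a Z Y) x.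

Definition div_stressHH (m : nat) (eT : 'I_d -> E -> E) (eH : 'I_m -> E -> E)
    X x : R :=
  \sum_A nabla_stressHH eH (eT A) (eT A) X x.

End coordinate_maps.

Record manifold (R : realType) (d : nat) := Manifold {
  point_of :> topologicalType ;
  chart : Type ;
  dom : chart -> set point_of ;
  coord : chart -> point_of -> 'rV[R]_d ;
  param : chart -> 'rV[R]_d -> point_of ;
  manifold_hausdorff : hausdorff_space point_of ;
  manifold_second_countable : @second_countable point_of ;
  dom_cover : forall p, exists i, dom i p ;
  dom_open : forall i, open (dom i) ;
  img_open : forall i, open (coord i @` dom i) ;
  coordK : forall i p, dom i p -> param i (coord i p) = p ;
  coord_continuous : forall i p, dom i p -> {for p, continuous (coord i)} ;
  param_continuous : forall i x, (coord i @` dom i) x ->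
    {for x, continuous (param i)} ;
  transition_smooth : forall i j,
    smooth_on (coord i @` (dom i `&` dom j)) (coord j \o param i) }.

Section manifold_structures.
Context {R : realType} {d : nat}.
Implicit Type M : manifold R d.

Definition img M (i : chart M) : set 'rV[R]_d := coord i @` dom i.

(* Matrix of the change of components from chart i to chart j. *)
Definition change M (i j : chart M) (x : 'rV[R]_d) : 'M[R]_d :=
  'J (coord j \o param i) x.

Definition vector_field M (X : chart M -> 'rV[R]_d -> 'rV[R]_d) :=
  (forall i, smooth_on (img i) (X i)) /\
  (forall i j p, dom i p -> dom j p ->
     X j (coord j p) = X i (coord i p) *m change i j (coord i p)).

Record metric M := Metric {
  metric_mx :> chart M -> 'rV[R]_d -> 'M[R]_d ;
  metric_smooth : forall i, smooth_on (img i) (metric_mx i) ;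
  metric_sym : forall i x, img i x -> (metric_mx i x)^T = metric_mx i x ;
  metric_pos : forall i x, img i x ->
    forall u, u != 0 -> 0 < inner (metric_mx i x) u u ;
  metric_change : forall i j p, dom i p -> dom j p ->
    metric_mx i (coord i p) =
    change i j (coord i p) *m metric_mx j (coord j p)
      *m (change i j (coord i p))^T }.

(* A rank k distribution that is integrable: every point lies on an integral
   manifold, here given by a local parametrization s, whose tangent spaces
   are the subspaces of the distribution. *)
Record foliation M (k : nat) := Foliation {
  dist_mx :> chart M -> 'rV[R]_d -> 'M[R]_d ;
  dist_rank : forall i x, img i x -> \rank (dist_mx i x) = k ;
  dist_smooth : forall i x, img i x ->
    exists (A : set 'rV[R]_d) (B : 'rV[R]_d -> 'M[R]_(k, d)),
      [/\ open A, A x, A `<=` img i, smooth_on A B &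
          forall y, A y -> (B y == dist_mx i y)%MS] ;
  dist_change : forall i j p, dom i p -> dom j p ->
    (dist_mx j (coord j p)
      == dist_mx i (coord i p) *m change i j (coord i p))%MS ;
  dist_integrable : forall i x, img i x ->
    exists (O : set 'rV[R]_k) (s : 'rV[R]_k -> 'rV[R]_d),
      [/\ open O, O 0, s 0 = x, smooth_on O s &
          forall t, O t -> img i (s t) /\ ('J s t == dist_mx i (s t))%MS] }.

Definition local_geom M k (F : foliation M k) (g : metric M) (i : chart M)
  : geom R d := Geom (g i) (F i).

(* L_U g_H = 0 for all sections U of the distribution over open sets. *)
Definition riemannian_foliation M k (F : foliation M k) (g : metric M) :=
  forall (i : chart M) (A : set 'rV[R]_d) (U X Y : 'rV[R]_d -> 'rV[R]_d),
    open A -> A `<=` img i ->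
    smooth_on A U -> smooth_on A X -> smooth_on A Y ->
    (forall x, A x -> (U x <= F i x)%MS) ->
    forall x, A x -> lie_gH (local_geom F g i) U X Y x = 0.

End manifold_structures.

Section maps.
Context {R : realType} {d d' : nat} {M : manifold R d} {N : manifold R d'}.
Variable f : M -> N.

Definition overlap (i : chart M) (j : chart N) : set 'rV[R]_d :=
  coord i @` (dom i `&` f @^-1` dom j).

Definition rep (i : chart M) (j : chart N) : 'rV[R]_d -> 'rV[R]_d' :=
  coord j \o f \o param i.

Definition smooth_map :=
  continuous f /\ forall i j, smooth_on (overlap i j) (rep i j).

Definition foliated_map k l (F : foliation M k) (F' : foliation N l) :=
  forall i j x, overlap i j x ->
    forall u, (u <= F i x)%MS -> ('d (rep i j) x u <= F' j (rep i j x))%MS.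

(* m is the rank of the horizontal distribution of M. *)
Definition horizontally_harmonic m k l (F : foliation M k) (g : metric M)
    (F' : foliation N l) (g' : metric N) :=
  forall i j (A : set 'rV[R]_d) (eT : 'I_d -> 'rV[R]_d -> 'rV[R]_d)
         (eH : 'I_m -> 'rV[R]_d -> 'rV[R]_d),
    open A -> A `<=` overlap i j ->
    orthonormal_frame (local_geom F g i) A eT ->
    horizontal_frame (local_geom F g i) A eH ->
    forall x, A x ->
      tensionHH (local_geom F g i) (local_geom F' g' j) (rep i j) eT eH x = 0.

Definition transversally_harmonic m k l (F : foliation M k) (g : metric M)
    (F' : foliation N l) (g' : metric N) :=
  horizontally_harmonic m F g F' g' /\ foliated_map F F'.

End maps.

(* Main.v *)
Require Import Defs.
From mathcomp Require Import all_boot all_order all_algebra.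
From mathcomp Require Import all_classical all_reals all_analysis.
From mathcomp Require Import ring lra.
Set Implicit Arguments.
Unset Strict Implicit.
Unset Printing Implicit Defensive.
Import Order.TTheory GRing.Theory Num.Theory.
Import numFieldNormedType.Exports.
Local Open Scope classical_set_scope.
Local Open Scope ring_scope.

(** Write phi for df_(H, H~), psi for df_(H, V~), beta for beta_(H, H~), T~ for
    the integrability tensor of the target, and e for |phi|^2 / 2, so that
    S(X, Y) = e g(X, Y) - <phi X, phi Y>.  For any smooth map,
      (div S)(X) = - <tr beta, phi X>
                   + sum_A <phi e_A, beta(X, e_A) - beta(e_A, X)>:
    this is [div_stress], the divergence of tr(H)/2 g - H for an arbitrary
    symmetric form H, applied to the pull-back of the transverse metric,
    whose covariant derivative is expressed by beta ([inner_covH_pull]).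

    As f is foliated, phi is the horizontal part of df on all of TM
    ([dHHE]).  Since the full second fundamental form of f is symmetric, the
    antisymmetric part of beta comes from the vertical part of df alone, and
    its horizontal component involves <nabla_(df X) U, xi> with U vertical and
    xi horizontal.  There the component of df X along the leaves contributes
    the second fundamental form of the leaves, which cancels by symmetry (the
    distribution is integrable), and the transverse component contributes T~.
    As T~ is skew on a Riemannian foliation ([Ttens_skew]), what remains is
      sum_A <psi e_A, T~_(phi X) (phi e_A)>
        = - sum_i <T~*_(phi e_i) (psi e_i), phi X>,
    the last sum being over a horizontal frame because phi kills vertical
    vectors ([frame_trace]).  Hence (div S)(X) = - <tau, phi X>, where tau is
    the tension field: the W~ terms of tau are vertical and do not pair with
    phi X.

    In a chart, a covariant derivative of a field of matrices is the ordinary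
    derivative corrected by the matrices [chr_mx] of Christoffel symbols.  On
    the target everything is expressed by the orthogonal projector Q on H~: T~
    and the second fundamental form of the leaves are the two off-diagonal
    blocks of nabla Q, so that the properties used above are consequences of
    Q Q = Q, of the self-adjointness of Q, of integrability and of the
    invariance of the transverse metric ([antisym_cov], [oneill_skew]).
    Analytically this requires Q to be differentiable, which follows from the
    formula P = G B^T (B G B^T)^-1 B for the projector on the rows of B, and
    the symmetry of second derivatives, both for f and for the local
    parametrizations of the leaves. *)

(** * Differential calculus of matrix-valued functions *)

Section calculus.
Context {R : realType} {V : normedModType R}.

(** Both the differential and the remainder estimate are local. *)
Lemma near_eq_differentiable {W : normedModType R} (f g : V -> W) (x : V) :
  (\near x, f x = g x) -> differentiable f x -> differentiable g x.
Proof.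
move=> fg df; have [dfc dfe] := (diff_locallyP x f).1 df.
have ge : g \o shift x = cst (g x) + 'd f x +o_ 0 id.
  apply/eqaddoP => _/posnumP[e].
  have {}dfe := (eqaddoP _ _ _ _).1 dfe e%:num ltac:(by []).
  have fg0 : \forall h \near 0, f (h + x) = g (h + x).
    by move: fg; rewrite [\near x, _](near_shift 0) subr0.
  have fgx : f x = g x by exact: nbhs_singleton fg.
  near=> h.
  have -> : (g \o shift x - (cst (g x) + 'd f x)) h =
    (f \o shift x - (cst (f x) + 'd f x)) h.
    by rewrite !fctE /= -fgx (near fg0 h).
  by near: h.
apply/diff_locallyP; rewrite (diff_unique dfc ge).
by split.
Unshelve. all: by end_near. Qed.

Lemma is_derive_mx m n (M : V -> 'M[R]_(m, n)) x v (dM : 'M[R]_(m, n)) :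
  (forall i j, is_derive x v (fun z => M z i j : R) (dM i j)) ->
  is_derive x v M dM.
Proof.
move=> h; have d : derivable M x v.
  by apply/derivable_mxP => i j; have [] := h i j.
apply: DeriveDef => //; rewrite derive_mx//; apply/matrixP => i j.
by rewrite mxE; have [_] := h i j.
Qed.

Lemma is_derive_coord m n (M : V -> 'M[R]_(m, n)) x v (dM : 'M[R]_(m, n)) i j :
  is_derive x v M dM -> is_derive x v (fun z => M z i j : R) (dM i j).
Proof.
move=> [d <-]; apply: DeriveDef; first exact: (derivable_mxP _ _ _).1.
by rewrite derive_mx// mxE.
Qed.

Lemma is_derive_mulmx m n p (A : V -> 'M[R]_(m, n)) (B : V -> 'M[R]_(n, p)) x v
    dA dB : is_derive x v A dA -> is_derive x v B dB ->
  is_derive x v (fun z => A z *m B z) (dA *m B x + A x *m dB).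
Proof.
move=> hA hB; apply: is_derive_mx => i j.
have -> : (fun z => (A z *m B z) i j : R) =
    \sum_k ((fun z => A z i k) * (fun z => B z k j)).
  by apply/funext => z; rewrite mxE fct_sumE.
have -> : (dA *m B x + A x *m dB) i j =
    \sum_k (A x i k *: dB k j + B x k j *: dA i k).
  rewrite !mxE -big_split; apply: eq_bigr => k _.
  by rewrite addrC /GRing.scale/= [dA i k * _]mulrC.
apply: is_derive_sum => k.
by apply: is_deriveM; exact: is_derive_coord.
Qed.

Lemma is_derive_trmx m n (A : V -> 'M[R]_(m, n)) x v dA :
  is_derive x v A dA -> is_derive x v (fun z => (A z)^T) dA^T.
Proof.
move=> hA; apply: is_derive_mx => i j; rewrite mxE.
rewrite (_ : (fun z => _) = (fun z => A z j i)); first exact: is_derive_coord.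
by apply/funext => z; rewrite mxE.
Qed.

Lemma is_deriveE {W : normedModType R} (f : V -> W) x v df :
  is_derive x v f df -> 'D_v f x = df.
Proof. by case. Qed.

Lemma differentiable_is_derive {W : normedModType R} (f : V -> W) x v :
  differentiable f x -> is_derive x v f ('D_v f x).
Proof. by move=> df; apply/derivableP/diff_derivable. Qed.

Lemma differentiable_mx m n (M : V -> 'M[R]_(m, n)) x :
  (forall i j, differentiable (fun z => M z i j : R) x) -> differentiable M x.
Proof.
move=> h.
have -> : M = \sum_i (\sum_j (fun z => M z i j *: delta_mx i j)).
  apply/funext => z; rewrite fct_sumE [LHS]matrix_sum_delta.
  by apply: eq_bigr => i _; rewrite fct_sumE.
apply: differentiable_sum => i; apply: differentiable_sum => j.
exact: differentiableZl.
Qed.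

Lemma differentiable_entry m n (M : V -> 'M[R]_(m, n)) x i j :
  differentiable M x -> differentiable (fun z => M z i j : R) x.
Proof.
move=> dM; apply: (@differentiable_comp _ _ _ _ M (fun N => N i j)) => //.
exact: differentiable_coord.
Qed.

Lemma differentiable_mulmx m n p (A : V -> 'M[R]_(m, n)) (B : V -> 'M[R]_(n, p)) x :
  differentiable A x -> differentiable B x ->
  differentiable (fun z => A z *m B z) x.
Proof.
move=> hA hB; apply: differentiable_mx => i j.
have -> : (fun z => (A z *m B z) i j : R) =
    \sum_k ((fun z => A z i k) * (fun z => B z k j)).
  by apply/funext => z; rewrite mxE fct_sumE.
apply: differentiable_sum => k.
by apply: differentiableM; exact: differentiable_entry.
Qed.

Lemma differentiable_trmx m n (A : V -> 'M[R]_(m, n)) x :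
  differentiable A x -> differentiable (fun z => (A z)^T) x.
Proof.
move=> hA; apply: differentiable_mx => i j.
rewrite (_ : (fun z => _) = (fun z => A z j i)); first exact: differentiable_entry.
by apply/funext => z; rewrite mxE.
Qed.

Lemma differentiable_prod (I : Type) (r : seq I) (f : I -> V -> R) x :
  (forall i, differentiable (f i) x) ->
  differentiable (fun z => \prod_(i <- r) f i z) x.
Proof.
move=> h; elim: r => [|i r ih].
  rewrite (_ : (fun z => _) = cst 1); first exact: differentiable_cst.
  by apply/funext => z; rewrite big_nil.
rewrite (_ : (fun z => _) = f i * (fun z => \prod_(i <- r) f i z)).
  exact: differentiableM.
by apply/funext => z; rewrite big_cons.
Qed.

Lemma differentiable_bigsum (I : Type) (r : seq I) (f : I -> V -> R) x :
  (forall i, differentiable (f i) x) ->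
  differentiable (fun z => \sum_(i <- r) f i z) x.
Proof.
move=> h; elim: r => [|i r ih].
  rewrite (_ : (fun z => _) = cst 0); first exact: differentiable_cst.
  by apply/funext => z; rewrite big_nil.
rewrite (_ : (fun z => _) = f i + (fun z => \sum_(i <- r) f i z)).
  exact: differentiableD.
by apply/funext => z; rewrite big_cons.
Qed.

Lemma differentiable_det n (M : V -> 'M[R]_n) x :
  differentiable M x -> differentiable (fun z => \det (M z)) x.
Proof.
move=> dM; rewrite /determinant; apply: differentiable_bigsum => s.
apply: (@differentiableM _ _ (cst _)); first exact: differentiable_cst.
by apply: differentiable_prod => i; exact: differentiable_entry.
Qed.

(** By Cramer's rule the entries of the inverse are quotients of polynomials in
    the entries. *)
Lemma differentiable_invmx n (M : V -> 'M[R]_n) x :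
  (\forall z \near x, M z \in unitmx) -> differentiable M x ->
  differentiable (fun z => invmx (M z)) x.
Proof.
move=> Mu dM.
apply: (@near_eq_differentiable _ (fun z => (\det (M z))^-1 *: \adj (M z))).
  by near=> z; rewrite /invmx ifT//; near: z.
apply: differentiable_mx => i j.
rewrite (_ : (fun z => _) =
    (fun z => (\det (M z))^-1) * (fun z => (\adj (M z)) i j)); last first.
  by apply/funext => z; rewrite mxE.
apply: differentiableM.
  apply: differentiableV; first exact: differentiable_det.
  by have := nbhs_singleton Mu; rewrite unitmxE unitfE.
rewrite (_ : (fun z => _) = cst ((-1) ^+ (j + i)) *
    (fun z => \det (row' j (col' i (M z))))); last first.
  by apply/funext => z; rewrite mxE.
apply: differentiableM; first exact: differentiable_cst.
apply: differentiable_det; apply: differentiable_mx => i' j'.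
rewrite (_ : (fun z => _) = (fun z => M z (lift j i') (lift i j'))).
  exact: differentiable_entry.
by apply/funext => z; rewrite !mxE.
Unshelve. all: by end_near. Qed.

Lemma derive_comp {U W : normedModType R} (f : V -> U) (g : U -> W) x v :
  differentiable f x -> differentiable g (f x) ->
  'D_v (g \o f) x = 'D_('D_v f x) g (f x).
Proof.
move=> df dg; rewrite !deriveE//; last exact: differentiable_comp.
by rewrite diff_comp.
Qed.

End calculus.

(** * Symmetry of second derivatives *)

Section schwarz.
Context {R : realType} {V : normedModType R}.
Implicit Types (f : V -> R) (x p u v : V).

Lemma is_derive_line f p u (t : R) : derivable f (p + t *: u) u ->
  is_derive t 1 (fun s : R => f (p + s *: u)) ('D_u f (p + t *: u)).
Proof.
move=> df.
have E : (fun h : R => h^-1 *: (f (p + (h *: 1 + t) *: u) - f (p + t *: u))) =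
         (fun h : R => h^-1 *: (f (h *: u + (p + t *: u)) - f (p + t *: u))).
  apply/funext => h; congr (_ *: (f _ - _)).
  by rewrite scalerDl [h *: 1]mulr1 addrCA.
by apply: DeriveDef; [rewrite /derivable E|rewrite /derive E].
Qed.

(** The mean value theorem applied first along u, to the difference of f
    between two lines, and then along v. *)
Lemma mixed_difference f x u v (e : R) : 0 < e ->
  (forall s t : R, 0 <= s <= e -> 0 <= t <= e ->
     derivable f (x + s *: u + t *: v) u /\
     derivable ('D_u f) (x + s *: u + t *: v) v) ->
  exists s t : R, [/\ 0 <= s <= e, 0 <= t <= e &
    f (x + e *: u + e *: v) - f (x + e *: u) - (f (x + e *: v) - f x)
      = 'D_v ('D_u f) (x + s *: u + t *: v) * e * e].
Proof.
move=> e0 h.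
have ee : 0 <= e <= e by apply/andP; split => //; exact: ltW.
have zz : 0 <= (0 : R) <= e by apply/andP; split => //; exact: ltW.
pose g (s : R) := f (x + e *: v + s *: u) - f (x + s *: u).
pose dg (s : R) := 'D_u f (x + e *: v + s *: u) - 'D_u f (x + s *: u).
have gd (s : R) : 0 <= s <= e -> is_derive s 1 g (dg s).
  move=> se; apply: is_deriveB; apply: is_derive_line.
    by rewrite [x + _ + _]addrAC; exact: (h s e se ee).1.
  by have := (h s 0 se zz).1; rewrite (scale0r v) addr0.
have [||s] := MVT e0 (f := g) (df := dg).
- by move=> s; rewrite in_itv/= => /andP[/ltW s0 /ltW s1]; apply: gd; rewrite s0.
- apply: derivable_within_continuous => s; rewrite in_itv/= => se.
  by have [] := gd s se.
rewrite in_itv/= => /andP[/ltW s0 /ltW s1].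
have se : 0 <= s <= e by rewrite s0.
rewrite /g /dg subr0 !scale0r !addr0 => gE.
pose k (t : R) := 'D_u f (x + s *: u + t *: v).
have kd (t : R) : 0 <= t <= e ->
    is_derive t 1 k ('D_v ('D_u f) (x + s *: u + t *: v)).
  by move=> te; apply: is_derive_line; have [] := h s t se te.
have [||t] := MVT e0 (f := k) (df := fun t => 'D_v ('D_u f) (x + s *: u + t *: v)).
- by move=> t; rewrite in_itv/= => /andP[/ltW t0 /ltW t1]; apply: kd; rewrite t0.
- apply: derivable_within_continuous => t; rewrite in_itv/= => te.
  by have [] := kd t te.
rewrite in_itv/= => /andP[/ltW t0 /ltW t1].
rewrite /k subr0 scale0r addr0 => kE.
exists s, t; split; rewrite ?s0 ?t0//.
by rewrite -kE [x + e *: u + _]addrAC gE [x + s *: u + _]addrAC.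
Qed.

(** The second difference of f on a small parallelogram is symmetric in u and
    v, and by [mixed_difference] it is a value of either mixed derivative at a
    point of the parallelogram, multiplied by the same factor. *)
Lemma schwarz f x u v :
  (\forall z \near x, derivable f z u /\ derivable f z v) ->
  (\forall z \near x, derivable ('D_u f) z v /\ derivable ('D_v f) z u) ->
  {for x, continuous ('D_v ('D_u f))} -> {for x, continuous ('D_u ('D_v f))} ->
  'D_v ('D_u f) x = 'D_u ('D_v f) x.
Proof.
move=> d1 d2 c1 c2; apply/eqP; rewrite -subr_eq0 -normr_le0.
apply/ler_addgt0Pl => e e0; rewrite addr0.
have e20 : 0 < e / 2 by rewrite divr_gt0.
have {}c1 : \forall z \near x, `|'D_v ('D_u f) x - 'D_v ('D_u f) z| < e / 2.
  exact: (cvgrPdist_lt _ _).1 c1 _ e20.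
have {}c2 : \forall z \near x, `|'D_u ('D_v f) x - 'D_u ('D_v f) z| < e / 2.
  exact: (cvgrPdist_lt _ _).1 c2 _ e20.
have [r /= r0 hr] := (nbhs_ballP _ _).1
  (@filterI _ (nbhs x) _ _ _ (@filterI _ (nbhs x) _ _ _ d1 d2)
    (@filterI _ (nbhs x) _ _ _ c1 c2)).
(* The parallelogram with sides d *: u and d *: v lies in the ball of radius r. *)
pose c := `|u| + `|v| + 1.
have c0 : 0 < c by rewrite ltr_wpDl// addr_ge0.
pose d := r / c.
have d0 : 0 < d by rewrite divr_gt0.
have close (s t : R) : 0 <= s <= d -> 0 <= t <= d -> ball x r (x + s *: u + t *: v).
  move=> /andP[s0 s1] /andP[t0 t1]; rewrite -ball_normE /ball_/=.
  rewrite opprD addrA opprD addrA subrr sub0r -opprD normrN.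
  apply: (le_lt_trans (ler_normD _ _)); rewrite !normrZ !ger0_norm//.
  have -> : r = d * `|u| + d * `|v| + d.
    by rewrite -{3}[d]mulr1 -!mulrDr -/c divfK// gt_eqF.
  by rewrite ltr_pwDr// lerD// ler_wpM2r.
have [s [t [sd td E1]]] : exists s t : R, [/\ 0 <= s <= d, 0 <= t <= d &
    f (x + d *: u + d *: v) - f (x + d *: u) - (f (x + d *: v) - f x)
      = 'D_v ('D_u f) (x + s *: u + t *: v) * d * d].
  apply: mixed_difference => // s t sd td.
  by have [[[? _] [? _]] _] := hr _ (close s t sd td).
have [s' [t' [sd' td' E2]]] : exists s t : R, [/\ 0 <= s <= d, 0 <= t <= d &
    f (x + d *: v + d *: u) - f (x + d *: v) - (f (x + d *: u) - f x)
      = 'D_u ('D_v f) (x + s *: v + t *: u) * d * d].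
  apply: mixed_difference => // s' t' sd' td'; rewrite [x + _ + _]addrAC.
  by split; [exact: (hr _ (close t' s' td' sd')).1.1.2|exact: (hr _ (close t' s' td' sd')).1.2.2].
pose a : R := 'D_v ('D_u f) (x + s *: u + t *: v).
pose b : R := 'D_u ('D_v f) (x + s' *: v + t' *: u).
have E : a = b.
  have d_neq0 : d != 0 by rewrite gt_eqF.
  apply: (mulIf d_neq0); apply: (mulIf d_neq0).
  transitivity (f (x + d *: v + d *: u) - f (x + d *: v) - (f (x + d *: u) - f x)).
    transitivity (f (x + d *: u + d *: v) - f (x + d *: u) - (f (x + d *: v) - f x)).
      exact: esym E1.
    rewrite [x + d *: v + _]addrAC.
    move: (f _) (f _) (f _) (f _) => f1 f2 f3 f4.
    by rewrite !opprB [RHS]addrACA [LHS]addrACA; congr (_ + _); exact: addrC.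
  exact: E2.
have [_ [/= h1 _]] := hr _ (close s t sd td).
have [_ [/= _ h2]] := hr _ (close t' s' td' sd').
have {}h2 : `|'D_u ('D_v f) x - a| < e / 2.
  by move: h2; rewrite E /b [x + s' *: v + _]addrAC.
apply: ltW; rewrite -(subrKA a).
apply: (le_lt_trans (ler_normD _ _)); rewrite [ltRHS]splitr.
apply: ltrD; first exact: h1.
by rewrite distrC; exact: h2.
Qed.

End schwarz.

(** * Inner products and the orthogonal splitting *)

Lemma trmxD {R : realType} m n (A B : 'M[R]_(m, n)) : (A + B)^T = A^T + B^T.
Proof. exact: linearD. Qed.

Lemma trmxB {R : realType} m n (A B : 'M[R]_(m, n)) : (A - B)^T = A^T - B^T.
Proof. exact: linearB. Qed.

Section inner.
Context {R : realType} {d : nat}.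
Implicit Types (G : 'M[R]_d) (u v w : 'rV[R]_d).

Lemma innerDl G u v w : inner G (u + v) w = inner G u w + inner G v w.
Proof. by rewrite /inner !mulmxDl mxE. Qed.

Lemma innerDr G u v w : inner G u (v + w) = inner G u v + inner G u w.
Proof. by rewrite /inner linearD mulmxDr mxE. Qed.

Lemma innerNl G u w : inner G (- u) w = - inner G u w.
Proof. by rewrite /inner !mulNmx mxE. Qed.

Lemma innerNr G u w : inner G u (- w) = - inner G u w.
Proof. by rewrite /inner linearN mulmxN mxE. Qed.

Lemma inner0l G u : inner G 0 u = 0.
Proof. by rewrite /inner !mul0mx mxE. Qed.

Lemma inner0r G u : inner G u 0 = 0.
Proof. by rewrite /inner linear0 mulmx0 mxE. Qed.

Lemma innerZl G c u w : inner G (c *: u) w = c * inner G u w.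
Proof. by rewrite /inner -!scalemxAl mxE. Qed.

Lemma innerZr G c u w : inner G u (c *: w) = c * inner G u w.
Proof. by rewrite /inner linearZ/= -scalemxAr mxE. Qed.

Lemma inner_suml n G (u : 'I_n -> 'rV[R]_d) w :
  inner G (\sum_i u i) w = \sum_i inner G (u i) w.
Proof. by rewrite /inner !mulmx_suml summxE. Qed.

Lemma inner_sumr n G u (w : 'I_n -> 'rV[R]_d) :
  inner G u (\sum_i w i) = \sum_i inner G u (w i).
Proof. by rewrite /inner linear_sum/= mulmx_sumr summxE. Qed.

Lemma inner_add (A B : 'M[R]_d) u v : inner (A + B) u v = inner A u v + inner B u v.
Proof. by rewrite /inner mulmxDr mulmxDl mxE. Qed.

Lemma inner_opp (A : 'M[R]_d) u v : inner (- A) u v = - inner A u v.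
Proof. by rewrite /inner mulmxN mulNmx mxE. Qed.

Lemma inner_mull (A K : 'M[R]_d) u v : inner (K *m A) u v = inner A (u *m K) v.
Proof. by rewrite /inner mulmxA. Qed.

Lemma inner_mulr (A K : 'M[R]_d) u v : inner (A *m K^T) u v = inner A u (v *m K).
Proof. by rewrite /inner trmx_mul !mulmxA. Qed.

Lemma innerC G u v : G^T = G -> inner G u v = inner G v u.
Proof.
move=> Gs; rewrite /inner -[in LHS](trmxK (u *m G *m v^T)) mxE.
by rewrite !trmx_mul trmxK Gs mulmxA.
Qed.

Lemma inner_adj G (A B : 'M[R]_d) u v : A *m G = G *m B^T ->
  inner G (u *m A) v = inner G u (v *m B).
Proof. by move=> h; rewrite /inner trmx_mul -(mulmxA u A) h !mulmxA. Qed.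

(** A vector in the kernel of G would have norm 0. *)
Lemma posdef_unit G : (forall u, u != 0 -> 0 < inner G u u) -> G \in unitmx.
Proof.
move=> pos; rewrite -row_free_unit -kermx_eq0; apply: contraT => /rowV0Pn[u uk u0].
have := pos u u0; rewrite /inner.
by move/sub_kermxP: uk => ->; rewrite mul0mx mxE ltxx.
Qed.

Lemma inner_inj G u v : G \in unitmx ->
  (forall w, inner G u w = inner G v w) -> u = v.
Proof.
move=> Gu h; apply: (can_inj (mulmxK Gu)); apply/rowP => j.
have := h (delta_mx 0 j); rewrite /inner trmx_delta -!colE [LHS]mxE [RHS]mxE.
by [].
Qed.

Lemma inner_pull d' (A : 'M[R]_d') (K L : 'M[R]_(d, d')) u v :
  inner (K *m A *m L^T) u v = inner A (u *m K) (v *m L).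
Proof. by rewrite /inner trmx_mul !mulmxA. Qed.

End inner.

Lemma is_derive_inner {R : realType} {V : normedModType R} d
    (G : V -> 'M[R]_d) (s t : V -> 'rV[R]_d) x v dG ds dt :
  is_derive x v G dG -> is_derive x v s ds -> is_derive x v t dt ->
  is_derive x v (fun z => inner (G z) (s z) (t z) : R)
    (inner (G x) ds (t x) + inner dG (s x) (t x) + inner (G x) (s x) dt).
Proof.
move=> hG hs ht.
have -> : inner (G x) ds (t x) + inner dG (s x) (t x) + inner (G x) (s x) dt =
    ((ds *m G x + s x *m dG) *m (t x)^T + s x *m G x *m dt^T) 0 0.
  by rewrite /inner mulmxDl [RHS]mxE [X in _ = X + _]mxE.
apply: is_derive_coord.
exact: is_derive_mulmx (is_derive_mulmx hs hG) (is_derive_trmx ht).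
Qed.

Section splitting.
Context {R : realType} {d : nat} (a : geom R d) (x : 'rV[R]_d).
Local Notation G := (gram a x).
Local Notation V := (vert a x).
Local Notation H := (hor a x).
Local Notation P := (piV a x).
Local Notation Q := (piH a x).
Hypothesis Gsym : G^T = G.
Hypothesis Gpos : forall u, u != 0 -> 0 < inner G u u.

Lemma hor_orth : H *m G *m V^T = 0.
Proof. by rewrite -mulmxA mulmx_ker. Qed.

Lemma hor_inner0 u v : (u <= H)%MS -> (v <= V)%MS -> inner G u v = 0.
Proof.
move=> /submxP[c ->] /submxP[e ->].
move: H hor_orth => K KV.
by rewrite /inner trmx_mul !mulmxA -2!(mulmxA c) KV mulmx0 mul0mx mxE.
Qed.

Lemma vert_cap_hor : (V :&: H = 0)%MS.
Proof.
apply/eqP; rewrite -submx0; apply/rV_subP => u.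
rewrite sub_capmx => /andP[uV uH]; rewrite submx0; apply: contraT => u0.
by have := Gpos u0; rewrite hor_inner0// ltxx.
Qed.

(** A count of dimensions: the rank of the kernel [hor a x] is d minus that of
    [vert a x], as G is invertible. *)
Lemma vert_add_hor : (1%:M <= V + H)%MS.
Proof.
have dr : \rank (V + H)%MS = d.
  rewrite mxrank_disjoint_sum ?vert_cap_hor// mxrank_ker.
  have GVt : (G *m V^T :=: V^T)%MS.
    by apply: eqmxMfull; rewrite row_full_unit posdef_unit.
  by rewrite GVt mxrank_tr addnC subnK// rank_leq_row.
by rewrite submx_full// /row_full dr.
Qed.

Lemma piVDpiH : P + Q = 1%:M.
Proof.
rewrite -[P]mul1mx -[Q]mul1mx add_proj_mx//; [exact: vert_cap_hor|].
exact: vert_add_hor.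
Qed.

Lemma piH_sub (u : 'rV_d) : (u *m Q <= H)%MS. Proof. exact: proj_mx_sub. Qed.
Lemma piV_sub (u : 'rV_d) : (u *m P <= V)%MS. Proof. exact: proj_mx_sub. Qed.

Lemma piV_id m (A : 'M[R]_(m, d)) : (A <= V)%MS -> A *m P = A.
Proof. by move=> AV; rewrite proj_mx_id// vert_cap_hor. Qed.

Lemma piH_id m (A : 'M[R]_(m, d)) : (A <= H)%MS -> A *m Q = A.
Proof. by move=> AH; rewrite proj_mx_id// capmxC vert_cap_hor. Qed.

Lemma piH_vert0 m (A : 'M[R]_(m, d)) : (A <= V)%MS -> A *m Q = 0.
Proof. by move=> AV; rewrite proj_mx_0// capmxC vert_cap_hor. Qed.

Lemma piH_proj : Q *m Q = Q.
Proof. by rewrite piH_id// -[Q]mul1mx proj_mx_sub. Qed.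

Lemma piVE : P = 1%:M - Q.
Proof. by rewrite -piVDpiH addrK. Qed.

Lemma piVH : P *m Q = 0.
Proof. by rewrite piVE mulmxBl mul1mx piH_proj subrr. Qed.

Lemma piH_gram_piV : Q *m G *m P^T = 0.
Proof.
apply/matrixP => i j; rewrite [RHS]mxE.
have := hor_inner0 (piH_sub (delta_mx 0 i)) (piV_sub (delta_mx 0 j)).
move: Q P => A B; rewrite /inner trmx_mul trmx_delta !mulmxA -rowE -!row_mul.
by rewrite -[_ *m delta_mx j 0]colE !mxE.
Qed.

Lemma piH_adj : Q *m G = G *m Q^T.
Proof.
have h : Q *m G = Q *m G *m Q^T.
  by rewrite -[LHS]mulmx1 -(trmx1 R d) -piVDpiH linearD mulmxDr piH_gram_piV add0r.
move: (Q) h => A h.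
by have := congr1 trmx h; rewrite !trmx_mul trmxK Gsym [RHS]mulmxA -h => ->.
Qed.

Lemma piV_adj : P *m G = G *m P^T.
Proof.
by rewrite piVE linearB/= trmx1 mulmxBl mulmxBr mul1mx mulmx1 piH_adj.
Qed.

Lemma inner_piH u v : inner G (u *m Q) v = inner G u (v *m Q).
Proof. exact/inner_adj/piH_adj. Qed.

(** Such a vector is vertical: its horizontal part is orthogonal to itself. *)
Lemma orth_hor_piH0 u : (forall w, (w <= H)%MS -> inner G u w = 0) -> u *m Q = 0.
Proof.
move=> h; apply: contraTeq isT => /Gpos.
by rewrite inner_piH -mulmxA piH_proj h ?ltxx// piH_sub.
Qed.

(** The formula that makes the projectors differentiable functions of the point
    ([piH_differentiable]).  As P has rows in the span of B, it is C B for some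
    C, and C is found from G B^T = C (B G B^T), which expresses that P is
    self-adjoint and fixes the rows of B. *)
Lemma piV_formula k (B : 'M[R]_(k, d)) : row_free B -> (B == V)%MS ->
  B *m G *m B^T \in unitmx /\ P = G *m B^T *m invmx (B *m G *m B^T) *m B.
Proof.
move=> Bfree BV.
have Mu : B *m G *m B^T \in unitmx.
  rewrite -row_free_unit -kermx_eq0; apply: contraT => /rowV0Pn[u uk u0].
  have uB0 : u *m B != 0.
    apply: contra_neq u0 => uB0; apply: (row_free_inj Bfree).
    by rewrite uB0 mul0mx.
  have := Gpos uB0; rewrite /inner trmx_mul !mulmxA.
  move/sub_kermxP: uk; rewrite !mulmxA => ->.
  by rewrite mul0mx mxE ltxx.
split=> //.
have BVs : (B <= V)%MS by case/andP: BV.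
have VBs : (V <= B)%MS by case/andP: BV.
have BP : B *m P = B by rewrite piV_id.
have PB : (P <= B)%MS by apply: submx_trans VBs; rewrite -[P]mul1mx proj_mx_sub.
have [C PC] := submxP PB.
have GBt : G *m B^T = C *m (B *m G *m B^T).
  by rewrite !mulmxA -PC piV_adj -mulmxA -trmx_mul BP.
by rewrite GBt mulmxK.
Qed.

End splitting.

(** * Christoffel symbols *)

Section partials.
Context {R : realType} {d : nat}.

Lemma derive_partial {W : normedModType R} (f : 'rV[R]_d -> W) x u :
  differentiable f x -> 'D_u f x = \sum_i u 0 i *: partial i f x.
Proof.
move=> df; rewrite deriveE// {1}[u]row_sum_delta linear_sum.
by apply: eq_bigr => i _; rewrite linearZ/= /partial deriveE.
Qed.

Lemma deriveDv {W : normedModType R} (f : 'rV[R]_d -> W) x u v :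
  differentiable f x -> 'D_(u + v) f x = 'D_u f x + 'D_v f x.
Proof. by move=> df; rewrite !deriveE// linearD. Qed.

End partials.

Section christoffel.
Context {R : realType} {d : nat} (a : geom R d) (x : 'rV[R]_d).
Local Notation G := (gram a x).

(** With vectors as rows, nabla_u Y = D_u Y + Y C(u): the covariant derivative
    becomes a matrix correction of the ordinary one ([chrE]). *)
Definition chr_mx (u : 'rV[R]_d) : 'M[R]_d :=
  \matrix_(j, k) \sum_i u 0 i * christoffel a x i j k.

Lemma chrE u v : chr a x u v = v *m chr_mx u.
Proof.
apply/rowP => k; rewrite !mxE exchange_big; apply: eq_bigr => j _.
rewrite mxE mulr_sumr; apply: eq_bigr => i _.
by rewrite mulrA [v 0 j * _]mulrC.
Qed.

Lemma chr_mxD u v : chr_mx (u + v) = chr_mx u + chr_mx v.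
Proof.
apply/matrixP => j k; rewrite !mxE -big_split; apply: eq_bigr => i _.
by rewrite mxE mulrDl.
Qed.

Hypothesis Gsym : \near x, (gram a x)^T = gram a x.

Lemma partial_gram_sym l i j :
  partial l (fun z => gram a z i j : R) x = partial l (fun z => gram a z j i : R) x.
Proof.
apply: near_eq_derive; near=> z.
have Gz : (gram a z)^T = gram a z by near: z.
by rewrite -[in LHS]Gz mxE.
Unshelve. all: by end_near. Qed.

Lemma chr_torsion_free u v : v *m chr_mx u = u *m chr_mx v.
Proof.
rewrite -!chrE; apply/rowP => k; rewrite !mxE exchange_big.
apply: eq_bigr => i _; apply: eq_bigr => j _.
rewrite [v 0 _ * _]mulrC; congr (_ * _); congr (_ * _).
apply: eq_bigr => l _; congr (_ * _).
by rewrite [partial l _ _]partial_gram_sym [X in X - _ = _]addrC.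
Qed.

Hypothesis Gdiff : differentiable (gram a) x.
Hypothesis Gunit : G \in unitmx.

(** The metric is parallel.  After multiplication by G the inverse Gram matrix
    in the Christoffel symbols disappears; C(u) G is then half of D_u G plus an
    antisymmetric matrix, and the latter cancels against its transpose. *)
Lemma chr_metric u : 'D_u (gram a) x = chr_mx u *m G + G *m (chr_mx u)^T.
Proof.
pose L : 'M[R]_d := \matrix_(j, l) (2^-1 * \sum_i u 0 i *
   (partial i (fun z => gram a z j l : R) x
    + partial j (fun z => gram a z i l : R) x
    - partial l (fun z => gram a z i j : R) x)).
have LE : chr_mx u *m G = L.
  suff -> : chr_mx u = L *m invmx G by rewrite mulmxKV.
  apply/matrixP => j k; rewrite !mxE /christoffel.
  under eq_bigr do rewrite mulrCA.
  rewrite -mulr_sumr; under [RHS]eq_bigr do rewrite mxE -mulrA.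
  rewrite -mulr_sumr; congr (_ * _).
  under eq_bigr do rewrite mulr_sumr.
  rewrite exchange_big; apply: eq_bigr => l _.
  by rewrite mulr_suml; apply: eq_bigr => i _; rewrite mulrA.
have -> : G *m (chr_mx u)^T = L^T.
  by rewrite -LE trmx_mul (nbhs_singleton Gsym).
rewrite LE; apply/matrixP => j l.
rewrite derive_mx; last exact: diff_derivable.
rewrite mxE derive_partial; last exact: differentiable_entry.
rewrite !mxE -mulrDr -big_split mulr_sumr; apply: eq_bigr => i _.
rewrite /= (partial_gram_sym i l j).
move: (partial i _ x) (partial j _ x) (partial l _ x) => p q r.
rewrite /GRing.scale/=.
by field.
Qed.

End christoffel.

(** * The derivative of an orthogonal projector *)

(** At one point, G is the metric, Q the orthogonal projector on the horizontal
    space, dG and dQ their derivatives in a given direction and C the matrices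
    of the Christoffel symbols.  The hypotheses are what the geometry provides
    by differentiation: Q Q = Q, the self-adjointness of Q, the metric property
    and torsion-freeness, then the integrability of the vertical distribution
    and the invariance of the transverse metric along it. *)
Section projector.
Context {R : realType} {d : nat} (G Q : 'M[R]_d) (dG dQ C : 'rV[R]_d -> 'M[R]_d).
Context (Gsym : G^T = G) (Gunit : G \in unitmx).
Context (QQ : Q *m Q = Q) (QG : Q *m G = G *m Q^T).
Context (dQQ : forall u, dQ u = dQ u *m Q + Q *m dQ u).
Context (dQG : forall u,
  dQ u *m G + Q *m dG u = dG u *m Q^T + G *m (dQ u)^T).
Context (dGE : forall u, dG u = C u *m G + G *m (C u)^T).
Context (dQD : forall u v, dQ (u + v) = dQ u + dQ v).
Context (CD : forall u v, C (u + v) = C u + C v).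
Context (Csym : forall u v, v *m C u = u *m C v).
Context (integrable : forall u v, u *m Q = 0 -> v *m Q = 0 ->
  v *m dQ u = u *m dQ v).
Context (killing : forall h w, h *m Q = h -> w *m Q = 0 ->
  inner G (h *m C w) h = inner G (w *m dQ h) h).

Local Notation P := (1%:M - Q).

(** The covariant derivative of Q in the direction u. *)
Definition cov u : 'M[R]_d := dQ u + Q *m C u - C u *m Q.
(** O'Neill's integrability tensor: the vertical part of nabla_u v for the
    horizontal extension v Q of v. *)
Definition oneill u v : 'rV[R]_d := (v *m dQ (u *m Q) + v *m Q *m C (u *m Q)) *m P.

Let PQ : P *m Q = 0.
Proof. by rewrite mulmxBl mul1mx QQ subrr. Qed.

Let QP : Q *m P = 0.
Proof. by rewrite mulmxBr mulmx1 QQ subrr. Qed.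

Let PP : P *m P = P.
Proof. by rewrite mulmxBr mulmx1 PQ subr0. Qed.

Lemma covD u v : cov (u + v) = cov u + cov v.
Proof.
rewrite /cov dQD CD mulmxDl mulmxDr.
move: (Q *m C u) (Q *m C v) (C u *m Q) (C v *m Q) (dQ u) (dQ v) => x1 x2 x3 x4 x5 x6.
by apply/matrixP => i j; rewrite !mxE; ring.
Qed.

(** The covariant derivative of the identity Q Q = Q: nabla Q exchanges the
    horizontal and the vertical space. *)
Lemma cov_offdiag u : cov u *m Q = P *m cov u.
Proof.
rewrite /cov !mulmxBl !mulmxBr !mulmxDl !mulmxDr !mul1mx !mulmxA QQ.
rewrite -(mulmxA (C u)) QQ [X in _ = X + _ - _ - _]dQQ.
move: (dQ u *m Q) (Q *m dQ u) (Q *m C u) (C u *m Q) (Q *m C u *m Q) => x1 x2 x3 x4 x5.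
by apply/matrixP => i j; rewrite !mxE; ring.
Qed.

(** The covariant derivative of the self-adjointness of Q. *)
Lemma cov_adj u : cov u *m G = G *m (cov u)^T.
Proof.
have E1 : C u *m Q *m G = C u *m G *m Q^T by rewrite -mulmxA QG mulmxA.
have E2 : G *m (Q^T *m (C u)^T) = Q *m G *m (C u)^T by rewrite mulmxA QG.
have := dQG u; rewrite dGE /cov trmxB trmxD (trmx_mul Q) (trmx_mul (C u)).
rewrite !mulmxDl !mulmxDr !mulmxN !mulNmx E1 E2 !mulmxA.
move: (dQ u *m G) (Q *m C u *m G) (Q *m G *m _) (C u *m G *m _)
  (G *m (C u)^T *m _) (G *m (dQ u)^T) => x1 x2 x3 x4 x5 x6 h.
apply/matrixP => i j; have := congr1 (fun M : 'M[R]_d => M i j) h.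
by rewrite !mxE => ?; lra.
Qed.

Lemma oneillE u v : oneill u v = v *m Q *m cov (u *m Q) *m P.
Proof.
rewrite /oneill /cov; move: (u *m Q) => w; move: P QP => p Qp.
have E : Q *m dQ w *m p = dQ w *m p.
  by rewrite [in RHS]dQQ mulmxDl -(mulmxA _ Q p) Qp mulmx0 add0r.
rewrite mulmxBr mulmxBl !mulmxDr !mulmxA -(mulmxA v Q Q) QQ.
rewrite -(mulmxA _ Q p) Qp mulmx0 subr0 !mulmxDl; congr (_ + _).
by rewrite -(mulmxA v) -E !mulmxA.
Qed.

Lemma oneillDl u v w : oneill (u + v) w = oneill u w + oneill v w.
Proof. by rewrite !oneillE mulmxDl covD (mulmxDr (w *m Q)) mulmxDl. Qed.

Lemma oneillDr u v w : oneill u (v + w) = oneill u v + oneill u w.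
Proof. by rewrite !oneillE !mulmxDl. Qed.

Let innerP u v : inner G (u *m P) v = inner G u (v *m P).
Proof.
apply: inner_adj; rewrite trmxB trmx1 mulmxBl mulmxBr mul1mx mulmx1.
by rewrite QG.
Qed.

Let innerQ u v : inner G (u *m Q) v = inner G u (v *m Q).
Proof. exact: inner_adj. Qed.

Let innerK u v w : inner G (v *m cov u) w = inner G v (w *m cov u).
Proof. exact/inner_adj/cov_adj. Qed.

(** On a vertical w, the covector <T_h h, .> takes the value <(nabla_h Q) w, h>,
    that is, -<nabla_h w, h> for a vertical extension of w.  By [killing] this
    vanishes, being up to sign half the derivative of the transverse metric
    along w. *)
Lemma oneill_diag u : oneill u u = 0.
Proof.
apply: (inner_inj Gunit) => w; rewrite inner0l oneillE innerP innerK.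
set h := u *m Q; have hQ : h *m Q = h by rewrite -mulmxA QQ.
set v := w *m P; have vQ : v *m Q = 0 by rewrite -mulmxA PQ mulmx0.
rewrite (innerC _ _ Gsym) /cov mulmxBr mulmxDr !mulmxA vQ mul0mx addr0.
by rewrite innerDl innerNl innerQ hQ Csym -killing// ?subrr// killing// subrr.
Qed.

Lemma oneill_skew u v : oneill u v = - oneill v u.
Proof.
have := oneill_diag (u + v).
rewrite oneillDl !oneillDr !oneill_diag add0r addr0 => /eqP.
by rewrite addr_eq0 => /eqP.
Qed.

(** The left-hand side is <q (nabla_p Q) - p (nabla_q Q), xi>.  Since nabla Q
    exchanges the two subspaces and is self-adjoint, only the vertical part of
    q counts in the first term and that of p in the second.  For p horizontal
    the first term is a value of T; for p vertical it is a second fundamental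
    form of the leaves, symmetric in p and q by integrability, and it cancels
    with its counterpart in the second term. *)
Lemma antisym_cov p q xi : xi *m Q = xi ->
  inner G (q *m dQ p - p *m dQ q + q *m Q *m C p - p *m Q *m C q) xi =
  inner G (q *m P) (oneill p xi) - inner G (p *m P) (oneill q xi).
Proof.
move=> xiQ.
have -> : q *m dQ p - p *m dQ q + q *m Q *m C p - p *m Q *m C q =
    q *m cov p - p *m cov q.
  rewrite /cov !mulmxBr !mulmxDr !mulmxA [q *m C p]Csym.
  move: (q *m dQ p) (p *m dQ q) (q *m Q *m C p) (p *m Q *m C q) (_ *m Q)
    => x1 x2 x3 x4 x5.
  by apply/rowP => i; rewrite !mxE; ring.
have half r s : inner G (s *m cov r) xi =
   inner G (s *m P) (oneill r xi) + inner G (s *m P *m dQ (r *m P) *m Q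
     - s *m P *m C (r *m P) *m Q) xi.
  rewrite -{1}xiQ -innerQ -mulmxA cov_offdiag mulmxA.
  have -> : cov r = cov (r *m Q) + cov (r *m P).
    by rewrite -covD -mulmxDr [Q + _]addrC subrK mulmx1.
  rewrite (mulmxDr (s *m P)) innerDl; congr (_ + _).
    by rewrite innerK -{1}PP mulmxA innerP oneillE xiQ.
  rewrite -[in LHS]xiQ -innerQ; congr inner.
  rewrite /cov; move: (r *m P) => w; move: P PQ => O OQ.
  rewrite mulmxBr mulmxBl !mulmxDr mulmxDl !mulmxA -(mulmxA s O Q) OQ.
  by rewrite mulmx0 !mul0mx addr0 -(mulmxA _ Q Q) QQ.
rewrite innerDl innerNl !half.
have -> : q *m P *m dQ (p *m P) *m Q - q *m P *m C (p *m P) *m Q =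
    p *m P *m dQ (q *m P) *m Q - p *m P *m C (q *m P) *m Q.
  rewrite integrable -?mulmxA ?PQ ?mulmx0//.
  by rewrite !mulmxA Csym.
by rewrite opprD addrACA subrr addr0.
Qed.

End projector.

(** * Smooth functions of several variables *)

Section smooth.
Context {R : realType} {d : nat} {V : normedModType R}.
Implicit Types (A : set 'rV[R]_d) (f : 'rV[R]_d -> V).

Lemma smooth_on_differentiable A f x : smooth_on A f -> A x -> differentiable f x.
Proof. by move=> /(_ 1%N)[+ _]; exact. Qed.

Lemma smooth_on_partial A f i : smooth_on A f -> smooth_on A (partial i f).
Proof. by move=> fs r; have [_] := fs r.+1; exact. Qed.

Lemma smooth_on_subset A A' f : A `<=` A' -> smooth_on A' f -> smooth_on A f.
Proof.
move=> AA' fs r; elim: r f {fs}(fs r) => [|r ih] f /=.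
  by move=> fc x /AA'; exact: fc.
by move=> [fd fp]; split=> [x /AA'|i]; [exact: fd|exact: ih].
Qed.

End smooth.

Section partial_comm.
Context {R : realType} {d : nat}.

Lemma open_near (A : set 'rV[R]_d) x : open A -> A x -> \near x, A x.
Proof. by move=> Ao Ax; exact: open_nbhs_nbhs. Qed.

(** [schwarz] for each component; the auxiliary equalities pass between the
    derivatives of a component and the components of a derivative. *)
Lemma partial_comm n (A : set 'rV[R]_d) (f : 'rV[R]_d -> 'rV[R]_n) i j x :
  open A -> smooth_on A f -> A x ->
  partial i (partial j f) x = partial j (partial i f) x.
Proof.
move=> Ao fs Ax; apply/rowP => c.
have coord (g : 'rV[R]_d -> 'rV[R]_n) (l : 'I_d) z : differentiable g z ->
    partial l (fun z => g z 0 c : R) z = partial l g z 0 c.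
  by move=> dg; rewrite /partial derive_mx ?mxE//; exact: diff_derivable.
have coordD (g : 'rV[R]_d -> 'rV[R]_n) z :
   differentiable g z -> differentiable (fun z => g z 0 c : R) z.
  exact: differentiable_entry.
have D1 z : A z -> differentiable f z by exact: smooth_on_differentiable.
have D2 l z : A z -> differentiable (partial l f) z.
  by apply: smooth_on_differentiable; exact: smooth_on_partial.
have D3 l l' z : A z -> differentiable (partial l' (partial l f)) z.
  by apply: smooth_on_differentiable; do 2!apply: smooth_on_partial.
have E1 l z : A z ->
    \near z, partial l f z 0 c = partial l (fun z => f z 0 c : R) z.
  move=> Az; near=> w; rewrite coord//; apply: D1.
  by near: w; exact: open_near.
have E2 l l' z : A z ->
    partial l' (partial l (fun z => f z 0 c : R)) z = partial l' (partial l f) z 0 c.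
  move=> Az; rewrite -coord; last exact: D2.
  by apply/esym/near_eq_derive; exact: E1.
have E2' l l' : \near x, partial l' (partial l f) x 0 c =
    partial l' (partial l (fun z => f z 0 c : R)) x.
  near=> w; rewrite E2//; near: w; exact: open_near.
apply: etrans (esym (E2 j i x Ax)) _; apply: etrans (E2 i j x Ax).
apply: schwarz.
- near=> z; have Az : A z by near: z; exact: open_near.
  by split; apply: diff_derivable; apply: coordD; exact: D1.
- near=> z; have Az : A z by near: z; exact: open_near.
  by split; apply: diff_derivable; apply: (near_eq_differentiable (E1 _ _ Az));
    apply: coordD; exact: D2.
- apply: differentiable_continuous; apply: (near_eq_differentiable (E2' _ _)).
  exact/coordD/D3.
- apply: differentiable_continuous; apply: (near_eq_differentiable (E2' _ _)).
  exact/coordD/D3.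
Unshelve. all: by end_near. Qed.

End partial_comm.

Section smooth_closure.
Context {R : realType} {d : nat}.
Implicit Types (A : set 'rV[R]_d).

(** Openness of A matters: it makes the derivatives of f and h agree on A as
    well, which the induction needs. *)
Lemma eq_Ck_on {V : normedModType R} r A (f h : 'rV[R]_d -> V) :
  open A -> (forall z, A z -> f z = h z) -> Ck_on r A f -> Ck_on r A h.
Proof.
move=> Ao; elim: r f h => [|r ih] f h fh /=.
  move=> fc z Az; change (h @ z --> h z); rewrite -(fh z Az).
  have fhz : \near z, f z = h z by apply: filterS (open_near Ao Az) => t /fh.
  exact: cvg_trans (near_eq_cvg fhz) (fc z Az).
move=> [fd fp]; split=> [z Az|i].
  apply: (near_eq_differentiable _ (fd z Az)).
  by apply: filterS (open_near Ao Az) => t /fh.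
apply: ih (fp i) => z Az; apply: near_eq_derive.
by apply: filterS (open_near Ao Az) => t /fh.
Qed.

Lemma smooth_on_cst {V : normedModType R} A (C : V) :
  smooth_on A (cst C : 'rV[R]_d -> V).
Proof.
move=> r; elim: r C => [|r ih] C /=; first by move=> x _; exact: cst_continuous.
split=> [x _|i]; first exact: differentiable_cst.
rewrite (_ : partial i (cst C) = cst 0); first exact: ih.
by apply/funext => x; exact: derive_cst.
Qed.

Lemma smooth_on_mulmxl m n p A (c : 'M[R]_(m, n)) (B : 'rV[R]_d -> 'M[R]_(n, p)) :
  open A -> smooth_on A B -> smooth_on A (fun z => c *m B z).
Proof.
move=> Ao Bs r; elim: r B Bs => [|r ih] B Bs.
  move=> x Ax; apply: differentiable_continuous; apply: differentiable_mulmx.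
    exact: differentiable_cst.
  exact: smooth_on_differentiable Bs Ax.
have Bd z : A z -> differentiable B z by exact: smooth_on_differentiable.
split=> [z Az|i].
  by apply: differentiable_mulmx; [exact: differentiable_cst|exact: Bd].
apply: eq_Ck_on (ih _ (smooth_on_partial i Bs)) => // z Az.
have dc := is_derive_cst c z (delta_mx 0 i : 'rV[R]_d).
have dB := differentiable_is_derive (delta_mx 0 i : 'rV[R]_d) (Bd z Az).
by rewrite /partial (is_deriveE (is_derive_mulmx dc dB)) mul0mx add0r.
Qed.

End smooth_closure.

(** * A foliated Riemannian manifold in a chart *)

(** Symmetry on a generating family extends by bilinearity. *)
Lemma sum_mulmx_sym {R : realType} d (I : finType) (p : I -> 'rV[R]_d)
    (K : I -> 'M[R]_d) (c e : I -> R) :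
  (forall i i', p i *m K i' = p i' *m K i) ->
  (\sum_i e i *: p i) *m (\sum_i c i *: K i) =
  (\sum_i c i *: p i) *m (\sum_i e i *: K i).
Proof.
move=> pK; rewrite !mulmx_suml; under eq_bigr do rewrite mulmx_sumr.
rewrite exchange_big; apply: eq_bigr => i _; rewrite mulmx_sumr.
apply: eq_bigr => i' _.
by rewrite -!scalemxAl -!scalemxAr pK scalerA mulrC -scalerA.
Qed.

Section foliated_chart.
Context {R : realType} {d k : nat} {N : manifold R d} (F : foliation N k)
  (g : metric N) (j : chart N).
Local Notation b := (local_geom F g j).
Implicit Types (y z u v w : 'rV[R]_d).

Lemma img_near y : img j y -> \near y, img j y.
Proof. by move=> yj; apply: open_nbhs_nbhs; split => //; exact: img_open. Qed.

Lemma gram_sym y : img j y -> (gram b y)^T = gram b y.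
Proof. by move=> yj; exact: (Defs.metric_sym g yj). Qed.

Lemma gram_pos y : img j y -> forall u, u != 0 -> 0 < inner (gram b y) u u.
Proof. by move=> yj; exact: (metric_pos g yj). Qed.

Lemma gram_near_sym y : img j y -> \near y, (gram b y)^T = gram b y.
Proof. by move=> /img_near; apply: filterS => z; exact: gram_sym. Qed.

Lemma gram_unit y : img j y -> gram b y \in unitmx.
Proof. by move=> yj; exact/posdef_unit/gram_pos. Qed.

Lemma gram_differentiable y : img j y -> differentiable (gram b) y.
Proof. exact/smooth_on_differentiable/metric_smooth. Qed.

Lemma local_basis y : img j y -> exists (B : 'rV[R]_d -> 'M[R]_(k, d)) A,
  [/\ open A, A y, A `<=` img j, smooth_on A B &
    forall z, A z -> row_free (B z) /\ (B z == vert b z)%MS].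
Proof.
move=> yj; have [A [B [Ao Ay Aj Bs BV]]] := dist_smooth F yj.
exists B, A; split=> // z Az; split; last exact: BV.
by rewrite /row_free (eqmxP (BV z Az)) (dist_rank F (Aj z Az)).
Qed.

Lemma piH_differentiable y : img j y -> differentiable (piH b) y.
Proof.
move=> yj; have [B [A [Ao Ay Aj Bs BV]]] := local_basis yj.
have Bd : differentiable B y by exact: smooth_on_differentiable Bs Ay.
have formula z : A z -> B z *m gram b z *m (B z)^T \in unitmx /\
    piV b z = gram b z *m (B z)^T *m invmx (B z *m gram b z *m (B z)^T) *m B z.
  move=> Az; have [Bf BVz] := BV z Az.
  by apply: piV_formula => //; [exact/gram_sym/Aj|exact/gram_pos/Aj].
have Gd := gram_differentiable yj.
have An := open_near Ao Ay.
apply: (@near_eq_differentiable _ _ _ (cst 1%:M - (fun z =>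
   gram b z *m (B z)^T *m invmx (B z *m gram b z *m (B z)^T) *m B z))).
  near=> z; have Az : A z by near: z.
  rewrite !fctE /= -(formula z Az).2.
  by rewrite -(piVDpiH (gram_pos (Aj z Az))) addrC addKr.
apply: differentiableB; first exact: differentiable_cst.
have Btd := differentiable_trmx Bd.
apply: differentiable_mulmx => //; apply: differentiable_mulmx.
  exact: differentiable_mulmx.
apply: differentiable_invmx; last by do 2!apply: differentiable_mulmx => //.
by near=> z; have /formula[] : A z by near: z.
Unshelve. all: by end_near. Qed.

Lemma derive_piH_proj y u : img j y ->
  'D_u (piH b) y = 'D_u (piH b) y *m piH b y + piH b y *m 'D_u (piH b) y.
Proof.
move=> yj; have dQ := differentiable_is_derive u (piH_differentiable yj).
rewrite -(is_deriveE (is_derive_mulmx dQ dQ)); apply: near_eq_derive.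
near=> z; have zj : img j z by near: z; exact: img_near.
by rewrite (piH_proj (gram_pos zj)).
Unshelve. all: by end_near. Qed.

Lemma derive_piH_adj y u : img j y ->
  'D_u (piH b) y *m gram b y + piH b y *m 'D_u (gram b) y =
  'D_u (gram b) y *m (piH b y)^T + gram b y *m ('D_u (piH b) y)^T.
Proof.
move=> yj; have dQ := differentiable_is_derive u (piH_differentiable yj).
have dG := differentiable_is_derive u (gram_differentiable yj).
rewrite -(is_deriveE (is_derive_mulmx dQ dG)).
rewrite -(is_deriveE (is_derive_mulmx dG (is_derive_trmx dQ))).
apply: near_eq_derive.
near=> z; have zj : img j z by near: z; exact: img_near.
by rewrite (piH_adj (gram_sym zj) (gram_pos zj)).
Unshelve. all: by end_near. Qed.

(** The second fundamental form of the leaves is symmetric.  Along a local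
    parametrization s of the leaf, the vectors d_i s are vertical, so
    (d_i s) Q(s) = 0.  Differentiating in the direction j gives
    (d_j d_i s) Q + d_i s (D_(d_j s) Q) = 0, and the first term is symmetric in
    i and j. *)
Lemma derive_piH_integrable y u v : img j y ->
  u *m piH b y = 0 -> v *m piH b y = 0 ->
  v *m 'D_u (piH b) y = u *m 'D_v (piH b) y.
Proof.
move=> yj uQ vQ.
have [D [s [Dopen D0 s0 ss sV]]] := dist_integrable F yj.
have sd t : D t -> differentiable s t by exact: smooth_on_differentiable.
have dQ : differentiable (piH b) (s 0) by rewrite s0; exact: piH_differentiable.
have basic i i' : partial i s 0 *m 'D_(partial i' s 0) (piH b) y =
    partial i' s 0 *m 'D_(partial i s 0) (piH b) y.
  have E l l' w : partial l' (partial l s) 0 = w ->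
      w *m piH b y + partial l s 0 *m 'D_(partial l' s 0) (piH b) y = 0.
    move=> <-.
    have dp : is_derive 0 (delta_mx 0 l') (partial l s) (partial l' (partial l s) 0).
      apply: differentiable_is_derive.
      exact: (smooth_on_differentiable (smooth_on_partial l ss) D0).
    have dQs : is_derive 0 (delta_mx 0 l') (piH b \o s)
        ('D_(partial l' s 0) (piH b) y).
      rewrite -s0 -derive_comp//; last exact: sd.
      apply: differentiable_is_derive; apply: differentiable_comp => //; exact: sd.
    have := is_deriveE (is_derive_mulmx dp dQs); rewrite /comp s0 => <-.
    rewrite -[RHS](derive_cst (V := 'rV[R]_k) (0 : 'rV[R]_d) 0 (delta_mx 0 l')).
    apply: near_eq_derive.
    near=> t; have Dt : D t by near: t; exact: open_near.
    have [st /andP[Js _]] := sV t Dt.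
    apply: (piH_vert0 (gram_pos st)).
    rewrite /partial deriveEjacobian; last exact: sd.
    by apply: submx_trans Js; exact: submxMl.
  have E1 := E i i' _ erefl; have E2 := E i' i _ (partial_comm _ _ Dopen ss D0).
  exact: addrI (etrans E1 (esym E2)).
have span w : w *m piH b y = 0 -> exists c : 'I_k -> R, w = \sum_i c i *: partial i s 0.
  move=> wQ; have [_ /andP[_ VJ]] := sV 0 D0.
  have wV : (w <= vert b y)%MS.
    have := piVDpiH (gram_pos yj) => PQ1.
    by rewrite -[w]mulmx1 -PQ1 mulmxDr wQ addr0 piV_sub.
  have /submxP[c wc] : (w <= 'J s 0)%MS.
    by apply: submx_trans VJ; rewrite s0.
  exists (c 0); rewrite wc [in LHS](row_sum_delta c) mulmx_suml.
  apply: eq_bigr => i _; rewrite -scalemxAl /partial deriveEjacobian//; exact: sd.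
have [c ->] := span u uQ; have [e ->] := span v vQ.
have lin (a : 'I_k -> R) : 'D_(\sum_i a i *: partial i s 0) (piH b) y =
    \sum_i a i *: 'D_(partial i s 0) (piH b) y.
  rewrite -s0 deriveE// linear_sum; apply: eq_bigr => i _.
  by rewrite linearZ/= deriveE.
rewrite !lin; exact: (@sum_mulmx_sym _ _ _ (fun i => partial i s 0)
  (fun i => 'D_(partial i s 0) (piH b) y)).
Unshelve. all: by end_near. Qed.

End foliated_chart.

(** * Invariance of the transverse metric *)

Section riemannian.
Context {R : realType} {d k : nat} {N : manifold R d} (F : foliation N k)
  (g : metric N) (j : chart N).
Local Notation b := (local_geom F g j).
Implicit Types (y z u v w : 'rV[R]_d).

Lemma chr_metric_chart y u : img j y ->
  'D_u (gram b) y = chr_mx b y u *m gram b y + gram b y *m (chr_mx b y u)^T.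
Proof.
move=> yj; apply: chr_metric; [exact: gram_near_sym|exact: gram_differentiable|].
exact: gram_unit.
Qed.

Lemma chr_sym_chart y u v : img j y -> v *m chr_mx b y u = u *m chr_mx b y v.
Proof. by move=> yj; apply/chr_torsion_free/gram_near_sym. Qed.

(** The invariance of the transverse metric, applied to the vertical field
    U = c B with B a local basis of the distribution and to fields X = Y = h
    that are constant in the chart.  The bracket [U, h] is then -D_h U, and
    U Q = 0 turns (D_h U) Q into - w (D_h Q); the derivative of the metric along
    w contributes 2 <h C(w), h>. *)
Lemma riemannian_killing y h w : riemannian_foliation F g -> img j y ->
  h *m piH b y = h -> w *m piH b y = 0 ->
  inner (gram b y) (h *m chr_mx b y w) h =
  inner (gram b y) (w *m 'D_h (piH b) y) h.
Proof.
move=> Riem yj hQ wQ.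
have Gs := gram_sym F g yj.
have [B [A [Ao Ay Aj Bs BV]]] := local_basis F g yj.
have [c wE] : exists c : 'rV_k, w = c *m B y.
  have [_ /andP[_ VB]] := BV y Ay.
  apply/submxP; apply: submx_trans VB.
  have PQ1 := piVDpiH (gram_pos F g yj : forall u, u != 0 -> 0 < inner (gram b y) u u).
  by rewrite -[w]mulmx1 -PQ1 mulmxDr wQ addr0 piV_sub.
pose U z := c *m B z.
have := Riem j A U (cst h) (cst h) Ao Aj (smooth_on_mulmxl c Ao Bs)
  (smooth_on_cst A h) (smooth_on_cst A h).
have UV z : A z -> (U z <= F j z)%MS.
  by move=> Az; apply: submx_trans (submxMl _ _) _; have [_ /andP[]] := BV z Az.
move=> /(_ UV y Ay); rewrite /lie_gH /bracket.
have Uy : U y = w by [].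
rewrite Uy.
rewrite !derive_cst !sub0r.
have dU : is_derive y h U ('D_h U y).
  apply: differentiable_is_derive.
  apply: differentiable_mulmx; first exact: differentiable_cst.
  exact: smooth_on_differentiable Bs Ay.
have dQ u := differentiable_is_derive u (piH_differentiable F g yj).
have dG u := differentiable_is_derive u (gram_differentiable F g yj).
have UQ : 'D_h U y *m piH b y + w *m 'D_h (piH b) y = 0.
  rewrite -[in w *m _]Uy -(is_deriveE (is_derive_mulmx dU (dQ h))).
  rewrite -[RHS](derive_cst (V := 'rV[R]_d) (0 : 'rV[R]_d) y h).
  apply: near_eq_derive; apply: filterS (open_near Ao Ay) => z Az.
  exact: (piH_vert0 (gram_pos F g (Aj z Az)) (UV z Az)).
have dcst : is_derive y w (cst h) 0 by exact: is_derive_cst.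
have dhQ : is_derive y w (fun z => h *m piH b z) (h *m 'D_w (piH b) y).
  have := is_derive_mulmx (is_derive_cst h y w) (dQ w).
  by rewrite mul0mx add0r.
(* Q (D_w Q) Q = 0, by differentiating Q Q = Q. *)
have diag : inner (gram b y) (h *m 'D_w (piH b) y) h = 0.
  rewrite -{2}hQ -(inner_piH Gs (gram_pos F g yj)).
  have := congr1 (fun M => h *m M) (derive_piH_proj F g w yj).
  rewrite mulmxDr 2!(mulmxA h) hQ => /eqP; rewrite -subr_eq subrr => /eqP <-.
  exact: inner0l.
have sym2 : inner (chr_mx b y w *m gram b y + gram b y *m (chr_mx b y w)^T) h h =
    inner (gram b y) (h *m chr_mx b y w) h *+ 2.
  rewrite mulr2n; set r := (X in _ = X + X).
  rewrite /inner mulmxDr mulmxDl mxE; congr (_ + _); first by rewrite !mulmxA.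
  by rewrite /r (innerC _ _ Gs) /inner trmx_mul !mulmxA.
have DgH : 'D_w (fun z => gH b z h h : R) y =
    inner (gram b y) (h *m chr_mx b y w) h *+ 2.
  apply: etrans (is_deriveE (is_derive_inner (dG w) dhQ dhQ)) _; rewrite hQ.
  have -> : inner (gram b y) h (h *m 'D_w (piH b) y) = 0.
    by rewrite innerC.
  by rewrite diag add0r addr0 chr_metric_chart.
have gHE : gH b y (- 'D_h U y) h = inner (gram b y) (w *m 'D_h (piH b) y) h.
  rewrite /gH hQ; congr inner; rewrite mulNmx; apply/eqP.
  by rewrite eq_sym -addr_eq0 addrC UQ.
have gHE' : gH b y h (- 'D_h U y) = gH b y (- 'D_h U y) h.
  exact: innerC.
change ('D_w (fun z => gH b z h h : R) y - gH b y (- 'D_h U y) h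
  - gH b y h (- 'D_h U y) = 0 -> inner (gram b y) (h *m chr_mx b y w) h =
  inner (gram b y) (w *m 'D_h (piH b) y) h).
rewrite DgH gHE' gHE.
rewrite -addrA -opprD -mulr2n -mulrnBl => /eqP.
by rewrite mulrn_eq0 subr_eq0 => /eqP.
Qed.

End riemannian.

(** * The tensor T of a Riemannian foliation *)

Section oneill_tensor.
Context {R : realType} {d k : nat} {N : manifold R d} (F : foliation N k)
  (g : metric N) (j : chart N) (y : 'rV[R]_d).
Local Notation b := (local_geom F g j).
Local Notation G := (gram b y).
Local Notation Q := (piH b y).
Local Notation dQ := (fun u => 'D_u (piH b) y).
Local Notation C := (chr_mx b y).
Implicit Types (u v w p q xi : 'rV[R]_d).
Context (yj : img j y).

Let Gs := gram_sym F g yj.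
Let Gp := gram_pos F g yj.
Let Gu := gram_unit F g yj.

Lemma TtensE u v : Ttens b y u v = oneill Q dQ C u v.
Proof.
rewrite /Ttens /nabla /oneill chrE (piVE Gp); congr ((_ + _) *m _).
have dv := differentiable_is_derive (u *m Q) (piH_differentiable F g yj).
have := is_deriveE (is_derive_mulmx (is_derive_cst v y (u *m Q)) dv).
by rewrite mul0mx add0r.
Qed.

(** The matrix of T_u, acting on rows from the right. *)
Definition Ttens_mx u : 'M[R]_d :=
  Q *m cov Q dQ C (u *m Q) *m (1%:M - Q).

Let covQ w := derive_piH_proj F g w yj.

Lemma Ttens_mxE u v : Ttens b y u v = v *m Ttens_mx u.
Proof.
rewrite TtensE oneillE//; last exact: (piH_proj Gp).
by rewrite /Ttens_mx; move: (Q) (cov _ _ _ _) (_ - _) => A B D; rewrite !mulmxA.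
Qed.

Lemma Wtens_vert u v : Wtens b y u v *m Q = 0.
Proof.
rewrite /Wtens; move: (nabla _ _ _ _) => w.
by rewrite mulNmx -mulmxA (piVH Gp) mulmx0 oppr0.
Qed.

Lemma Tadj_inner u w v : inner G (Tadj b y u w) v = inner G w (Ttens b y u v).
Proof.
have -> : Tadj b y u w = w *m G *m (Ttens_mx u)^T *m invmx G.
  rewrite /Tadj; congr (_ *m _); apply/rowP => i; rewrite mxE Ttens_mxE.
  by rewrite /inner trmx_mul mulmxA trmx_delta -colE mxE.
by rewrite Ttens_mxE /inner mulmxKV// (trmx_mul v) (mulmxA (w *m G)).
Qed.

Context (Riem : riemannian_foliation F g).

Lemma Ttens_skew u v : Ttens b y u v = - Ttens b y v u.
Proof.
rewrite !TtensE; apply: (oneill_skew (G := G) (dG := fun u => 'D_u (gram b) y)) => //.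
- exact: piH_proj.
- exact: piH_adj.
- by move=> w; exact: derive_piH_adj.
- by move=> w; exact: chr_metric_chart.
- by move=> p q; apply: deriveDv; exact: piH_differentiable.
- exact: chr_mxD.
- by move=> p q; exact: chr_sym_chart.
- by move=> h w hQ wQ; exact: riemannian_killing.
Qed.

(** [antisym_cov] for the projector field of a foliated Riemannian manifold. *)
Lemma antisym_cov_chart p q xi : xi *m Q = xi ->
  inner G (q *m dQ p - p *m dQ q + q *m Q *m C p - p *m Q *m C q) xi =
  inner G (q *m piV b y) (Ttens b y p xi)
    - inner G (p *m piV b y) (Ttens b y q xi).
Proof.
move=> xiQ; rewrite !TtensE (piVE Gp).
have h := @antisym_cov _ _ G Q (fun u => 'D_u (gram b) y) dQ C.
apply: h.
- exact: piH_proj.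
- exact: piH_adj.
- exact: covQ.
- by move=> w; exact: derive_piH_adj.
- by move=> w; exact: chr_metric_chart.
- by move=> u v; apply: deriveDv; exact: piH_differentiable.
- exact: chr_mxD.
- by move=> u v; exact: chr_sym_chart.
- by move=> u v; exact: derive_piH_integrable.
- exact: xiQ.
Qed.

End oneill_tensor.

(** * The divergence of a trace-reversed form *)

Lemma is_derive_bigsum {R : realType} {V : normedModType R} n (h : 'I_n -> V -> R)
    x v (dh : 'I_n -> R) :
  (forall i, is_derive x v (h i) (dh i)) ->
  is_derive x v (fun z => \sum_i h i z) (\sum_i dh i).
Proof.
move=> hd; rewrite (_ : (fun z => _) = \sum_i h i); first exact: is_derive_sum.
by apply/funext => z; rewrite fct_sumE.
Qed.

Section divergence.
Context {R : realType} {d : nat} (a : geom R d) (x : 'rV[R]_d)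
  (H : 'rV[R]_d -> 'M[R]_d) (e : 'I_d -> 'rV[R]_d -> 'rV[R]_d).
Local Notation E := 'rV[R]_d.
Local Notation G := (gram a x).
Implicit Types (X Y : E -> E) (u v w : E).
Context (Gsym : \near x, (gram a x)^T = gram a x)
  (Gdiff : differentiable (gram a) x) (Gunit : G \in unitmx).
Context (Hdiff : differentiable H x) (Hsym : (H x)^T = H x).
Context (ediff : forall A, differentiable (e A) x)
  (eorth : \near x, forall A B,
     inner (gram a x) (e A x) (e B x) = (A == B)%:R).

(** The values at x of nabla_u X and nabla_u H, for a vector field X and a field
    H of bilinear forms. *)
Definition covX u X : E := 'D_u X x + X x *m chr_mx a x u.
Definition covH u : 'M[R]_d :=
  'D_u H x - chr_mx a x u *m H x - H x *m (chr_mx a x u)^T.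

Lemma nablaE Z X : nabla a Z X x = covX (Z x) X.
Proof. by rewrite /nabla chrE. Qed.

Lemma is_derive_form u X Y : differentiable X x -> differentiable Y x ->
  is_derive x u (fun z => inner (H z) (X z) (Y z) : R)
    (inner (covH u) (X x) (Y x) + inner (H x) (covX u X) (Y x)
       + inner (H x) (X x) (covX u Y)).
Proof.
move=> dX dY.
have := is_derive_inner (differentiable_is_derive u Hdiff)
  (differentiable_is_derive u dX) (differentiable_is_derive u dY).
congr is_derive; rewrite /covX innerDl innerDr.
have -> : inner (covH u) (X x) (Y x) = inner ('D_u H x) (X x) (Y x)
    - inner (H x) (X x *m chr_mx a x u) (Y x)
    - inner (H x) (X x) (Y x *m chr_mx a x u).
  by rewrite !inner_add !inner_opp inner_mull inner_mulr.
move: (inner _ _ _) (inner _ _ _) (inner _ _ _) (inner _ _ _) => p q r s.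
move: (inner _ _ _) => t; ring.
Qed.

Lemma is_derive_metric u X Y : differentiable X x -> differentiable Y x ->
  is_derive x u (fun z => inner (gram a z) (X z) (Y z) : R)
    (inner G (covX u X) (Y x) + inner G (X x) (covX u Y)).
Proof.
move=> dX dY.
have := is_derive_inner (differentiable_is_derive u Gdiff)
  (differentiable_is_derive u dX) (differentiable_is_derive u dY).
congr is_derive; rewrite chr_metric// /covX innerDl innerDr.
have -> : inner (chr_mx a x u *m G + G *m (chr_mx a x u)^T) (X x) (Y x) =
    inner G (X x *m chr_mx a x u) (Y x) + inner G (X x) (Y x *m chr_mx a x u).
  by rewrite inner_add inner_mull inner_mulr.
move: (inner _ _ _) (inner _ _ _) (inner _ _ _) (inner _ _ _) => p q r s; ring.
Qed.

(** An orthonormal family of full length is a basis: E G E^T = 1 gives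
    G E^T E = 1 for square matrices. *)
Lemma frame_expand u : u = \sum_A inner G u (e A x) *: e A x.
Proof.
pose M : 'M[R]_d := \matrix_A e A x.
have eM C : e C x = delta_mx 0 C *m M by rewrite -rowE rowK.
have M1 : M *m (G *m M^T) = 1%:M.
  apply/matrixP => A B; rewrite [RHS]mxE -(nbhs_singleton eorth A B) /inner.
  have entry (K : 'M[R]_d) : K A B =
      ((delta_mx 0 A : 'rV_d) *m K *m (delta_mx B 0 : 'cV_d)) 0 0.
    by rewrite -rowE -colE !mxE.
  by rewrite entry !eM trmx_mul trmx_delta !mulmxA.
have := mulmx1C M1 => /(congr1 (fun K => u *m K)); rewrite mulmx1 => {1}<-.
rewrite !mulmxA mulmx_sum_row; apply: eq_bigr => A _; rewrite rowK; congr (_ *: _).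
by rewrite /inner eM trmx_mul trmx_delta mulmxA -colE [RHS]mxE.
Qed.

(** The derivative of the constant function <e_A, e_B>. *)
Lemma frame_skew u A B :
  inner G (covX u (e A)) (e B x) = - inner G (covX u (e B)) (e A x).
Proof.
apply/eqP; rewrite -addr_eq0 [X in _ + X](innerC _ _ (nbhs_singleton Gsym)).
rewrite -(is_deriveE (is_derive_metric u (ediff A) (ediff B))).
apply/eqP; rewrite -[RHS](derive_cst ((A == B)%:R : R) x u).
by apply: near_eq_derive; apply: filterS eorth => z; exact.
Qed.

(** The contraction of the antisymmetric connection matrix of the frame with the
    symmetric matrix H(e_B, e_A). *)
Lemma frame_trace_skew u : \sum_A inner (H x) (covX u (e A)) (e A x) = 0.
Proof.
pose w A B := inner G (covX u (e A)) (e B x).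
pose h A B := inner (H x) (e B x) (e A x).
have E A : inner (H x) (covX u (e A)) (e A x) = \sum_B w A B * h A B.
  rewrite {1}[covX u (e A)]frame_expand inner_suml.
  by apply: eq_bigr => B _; rewrite innerZl.
under eq_bigr do rewrite E.
set S := \sum_A _; have : S = - S.
  rewrite {1}/S exchange_big -sumrN; apply: eq_bigr => A _.
  rewrite -sumrN; apply: eq_bigr => B _.
  by rewrite /w frame_skew /h (innerC _ _ Hsym) mulNr.
by move/eqP; rewrite -addr_eq0 -mulr2n mulrn_eq0 => /eqP.
Qed.

Lemma is_derive_trace u :
  is_derive x u (fun z => \sum_A inner (H z) (e A z) (e A z) : R)
    (\sum_A inner (covH u) (e A x) (e A x)).
Proof.
have := is_derive_bigsum (fun A => is_derive_form u (ediff A) (ediff A)).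
congr is_derive; rewrite !big_split/= frame_trace_skew addr0.
under [X in _ + X]eq_bigr do rewrite (innerC _ _ Hsym).
by rewrite frame_trace_skew addr0.
Qed.

(** The form tr(H)/2 g - H; for H the pull-back of the transverse metric, it is
    the stress-energy tensor. *)
Definition stress X Y z : R :=
  2^-1 * (\sum_A inner (H z) (e A z) (e A z)) * inner (gram a z) (X z) (Y z)
    - inner (H z) (X z) (Y z).

Lemma is_derive_stress u X Y : differentiable X x -> differentiable Y x ->
  is_derive x u (stress X Y)
    (2^-1 * (\sum_A inner (covH u) (e A x) (e A x)) * inner G (X x) (Y x)
     - inner (covH u) (X x) (Y x)
     + stress (fun=> covX u X) (fun=> Y x) x + stress (fun=> X x) (fun=> covX u Y) x).
Proof.
move=> dX dY.
have dn := is_deriveM (is_derive_cst (2^-1 : R) x u) (is_derive_trace u).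
have := is_deriveB (is_deriveM dn (is_derive_metric u dX dY)) (is_derive_form u dX dY).
congr is_derive; rewrite /stress /GRing.scale/= mulr0 addr0 fctE.
move: (\sum_A _) (\sum_A _) => n dn'.
rewrite /cst.
move: (inner _ _ _) => p1; move: (inner _ _ _) => p2; move: (inner _ _ _) => p3.
move: (inner _ _ _) => p4; move: (inner _ _ _) => p5; move: (inner _ _ _) => p6.
by ring.
Qed.

(** The metric is parallel, so the divergence of tr(H)/2 g is half the
    differential of tr(H), and by [frame_trace_skew] the frame may be treated as
    parallel when the trace is differentiated. *)
Lemma div_stress X : differentiable X x ->
  \sum_A ('D_(e A x) (stress (e A) X) x
    - stress (fun=> nabla a (e A) (e A) x) (fun=> X x) x
    - stress (fun=> e A x) (fun=> nabla a (e A) X x) x) =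
  2^-1 * \sum_A inner (covH (X x)) (e A x) (e A x)
    - \sum_A inner (covH (e A x)) (e A x) (X x).
Proof.
move=> dX; pose n z := \sum_A inner (H z) (e A z) (e A z) : R.
have dn : differentiable n x.
  apply: differentiable_bigsum => A; apply: differentiable_entry.
  apply: differentiable_mulmx; first exact: differentiable_mulmx.
  exact: differentiable_trmx.
have nE u : \sum_A inner (covH u) (e A x) (e A x) = 'D_u n x.
  exact: esym (is_deriveE (is_derive_trace u)).
transitivity (\sum_A (2^-1 * (inner G (X x) (e A x) * 'D_(e A x) n x)
    - inner (covH (e A x)) (e A x) (X x))).
  apply: eq_bigr => A _; rewrite (is_deriveE (is_derive_stress _ (ediff A) dX)).
  rewrite !nablaE nE (innerC _ _ (nbhs_singleton Gsym)).
  move: (stress _ _ x) (stress _ _ x) ('D_(e A x) n x) => s1 s2 p.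
  move: (inner _ _ _) => q; move: (inner _ _ _) => r.
  by ring.
have nX : \sum_A inner G (X x) (e A x) * 'D_(e A x) n x = 'D_(X x) n x.
  rewrite [in RHS](frame_expand (X x)) deriveE// linear_sum.
  by apply: eq_bigr => A _; rewrite linearZ/= -deriveE.
by rewrite sumrB -mulr_sumr nX (nE (X x)).
Qed.

End divergence.

(** * Second derivatives of a map *)

Lemma diff_jacobian {R : realType} n p (h : 'rV[R]_n -> 'rV[R]_p) x u :
  'd h x u = u *m 'J h x.
Proof. by rewrite /jacobian mul_rV_lin1. Qed.

Section jacobian.
Context {R : realType} {d d' : nat} (h : 'rV[R]_d -> 'rV[R]_d') (A : set 'rV[R]_d).
Context (Aopen : open A) (hs : smooth_on A h).

Lemma row_jacobian i z : A z -> row i ('J h z) = partial i h z.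
Proof.
move=> Az; rewrite rowE -deriveEjacobian//; exact: smooth_on_differentiable hs Az.
Qed.

Lemma jacobian_differentiable x : A x -> differentiable (fun z => 'J h z) x.
Proof.
move=> Ax; apply: differentiable_mx => r c.
apply: (@near_eq_differentiable _ _ _ (fun z => partial r h z 0 c : R)).
  apply: filterS (open_near Aopen Ax) => z Az.
  by rewrite -row_jacobian// mxE.
apply: differentiable_entry.
exact: smooth_on_differentiable (smooth_on_partial r hs) Ax.
Qed.

(** The entries of D_w J are second derivatives of h: this is the symmetry of
    the second differential of h. *)
Lemma hessian_sym x v w : A x ->
  v *m 'D_w (fun z => 'J h z) x = w *m 'D_v (fun z => 'J h z) x.
Proof.
move=> Ax.
pose K i i' := partial i' (partial i h) x.
have rowD u i : row i ('D_u (fun z => 'J h z) x) = \sum_i' u 0 i' *: K i i'.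
  rewrite /K -derive_partial; last first.
    exact: smooth_on_differentiable (smooth_on_partial i hs) Ax.
  have dJ := differentiable_is_derive u (jacobian_differentiable Ax).
  have dr := is_derive_mulmx (is_derive_cst (delta_mx 0 i : 'rV[R]_d) x u) dJ.
  rewrite rowE -[LHS]add0r -[X in X + _ = _](mul0mx _ ('J h x)).
  rewrite -(is_deriveE dr).
  apply: near_eq_derive; apply: filterS (open_near Aopen Ax) => z Az.
  by rewrite -row_jacobian// rowE.
have expand u u' : u *m 'D_u' (fun z => 'J h z) x =
    \sum_i \sum_i' (u 0 i * u' 0 i') *: K i i'.
  rewrite mulmx_sum_row; apply: eq_bigr => i _; rewrite rowD scaler_sumr.
  by apply: eq_bigr => i' _; rewrite scalerA.
rewrite !expand exchange_big; apply: eq_bigr => i _; apply: eq_bigr => i' _.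
by rewrite mulrC /K (partial_comm i i' Aopen hs Ax).
Qed.

End jacobian.

(** * The second fundamental form of a foliated map *)

(** The covariant derivative of P G P^T, for G parallel, is obtained by
    differentiating the two factors P covariantly. *)
Lemma cov_form_mx {R : realType} d d' (dP P : 'M[R]_(d, d')) (C : 'M[R]_d)
    (C' G dG : 'M[R]_d') : G^T = G -> dG = C' *m G + G *m C'^T ->
  (dP *m G + P *m dG) *m P^T + P *m G *m dP^T
    - C *m (P *m G *m P^T) - (P *m G *m P^T) *m C^T =
  (dP + P *m C' - C *m P) *m G *m P^T + P *m G *m (dP + P *m C' - C *m P)^T.
Proof.
move=> Gs ->; rewrite trmxB trmxD (trmx_mul P C') (trmx_mul C P).
rewrite !mulmxBl !mulmxBr !mulmxDl !mulmxDr !mulmxDl !mulmxA.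
move: (dP *m G *m _) (P *m C' *m G *m _) (P *m G *m C'^T *m _) (P *m G *m dP^T)
  (C *m P *m G *m _) (P *m G *m P^T *m _) => p q r s t o.
by apply/matrixP => i j; rewrite !mxE; ring.
Qed.

Lemma cov_map_mx {R : realType} d d' (dP P : 'M[R]_(d, d')) (C : 'M[R]_d)
    (C' : 'M[R]_d') (Y dY : 'rV[R]_d) :
  dY *m P + Y *m dP + Y *m P *m C' - (dY + Y *m C) *m P =
  Y *m (dP + P *m C' - C *m P).
Proof.
rewrite mulmxBr !mulmxDr mulmxDl !mulmxA.
move: (dY *m P) (Y *m dP) (Y *m P *m C') (Y *m C *m P) => p q r s.
by apply/rowP => c; rewrite !mxE; ring.
Qed.

Section pullback.
Context {R : realType} {d d' k l : nat} {M : manifold R d} {N : manifold R d'}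
  (F : foliation M k) (g : metric M) (F' : foliation N l) (g' : metric N)
  (f : M -> N) (i : chart M) (j : chart N) (A : set 'rV[R]_d) (x : 'rV[R]_d).
Context (fs : smooth_map f) (fol : foliated_map f F F').
Context (Aopen : open A) (Aov : A `<=` overlap f i j) (Ax : A x).
Local Notation a := (local_geom F g i).
Local Notation b := (local_geom F' g' j).
Local Notation h := (rep f i j).
Local Notation J := (fun z => 'J h z).
Local Notation y := (h x).
Implicit Types (u v w : 'rV[R]_d) (X Y : 'rV[R]_d -> 'rV[R]_d).

Lemma overlap_img z : overlap f i j z -> img i z /\ img j (h z).
Proof.
move=> [p [pi pj] <-]; split; first by exists p.
by exists (f p) => //; rewrite /rep /= coordK.
Qed.

Let hsA : smooth_on A h.
Proof. by apply: smooth_on_subset Aov _; exact: fs.2. Qed.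

Let Ai z : A z -> img i z.
Proof. by move=> /Aov/overlap_img[]. Qed.

Let Aj z : A z -> img j (h z).
Proof. by move=> /Aov/overlap_img[]. Qed.

Let hd z : A z -> differentiable h z.
Proof. exact: smooth_on_differentiable. Qed.

(** The matrix of df_(H, H~).  The projector on the source side is omitted
    because df maps vertical vectors to vertical vectors ([dHHE]). *)
Definition Phi z : 'M[R]_(d, d') := J z *m piH b (h z).

Lemma vert_Phi0 z u : A z -> (u <= vert a z)%MS -> u *m Phi z = 0.
Proof.
move=> Az uV; have := fol (Aov Az) uV; rewrite diff_jacobian => duV.
by rewrite /Phi mulmxA; exact: (piH_vert0 (gram_pos F' g' (Aj Az)) duV).
Qed.

Lemma Phi_hor z : A z -> Phi z *m piH b (h z) = Phi z.
Proof. by move=> Az; rewrite /Phi -mulmxA (piH_proj (gram_pos F' g' (Aj Az))). Qed.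

Lemma dHHE z u : A z -> dHH a b h z u = u *m Phi z.
Proof.
move=> Az; rewrite /dHH diff_jacobian -mulmxA -/(Phi z).
have PQ := piVDpiH (gram_pos F g (Ai Az)).
rewrite -[in RHS](mulmx1 u) -PQ mulmxDr mulmxDl.
by rewrite (vert_Phi0 Az (piV_sub a z u)) add0r.
Qed.

Lemma Phi_differentiable : differentiable Phi x.
Proof.
apply: differentiable_mulmx; first exact: jacobian_differentiable Ax.
apply: (@differentiable_comp _ _ _ _ h (piH b)); first exact: hd.
exact/piH_differentiable/Aj.
Qed.

Lemma derive_Phi w : 'D_w Phi x =
  'D_w J x *m piH b y + 'J h x *m 'D_(w *m 'J h x) (piH b) y.
Proof.
have dJ := differentiable_is_derive w (jacobian_differentiable Aopen hsA Ax).
have Qd := piH_differentiable F' g' (Aj Ax).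
have dQ : is_derive x w (piH b \o h) ('D_(w *m 'J h x) (piH b) y).
  rewrite -deriveEjacobian; last exact: hd.
  rewrite -derive_comp//; last exact: hd.
  apply: differentiable_is_derive; apply: differentiable_comp => //; exact: hd.
exact: is_deriveE (is_derive_mulmx dJ dQ).
Qed.

(** The covariant derivative of Phi, as a section of Hom(TM, f^* TN); it
    represents beta_(H, H~) ([betaHHE]). *)
Definition beta_mx w : 'M[R]_(d, d') :=
  'D_w Phi x + Phi x *m chr_mx b y (w *m 'J h x) - chr_mx a x w *m Phi x.

Lemma betaHHE X Y : differentiable Y x ->
  betaHH a b h X Y x = Y x *m beta_mx (X x).
Proof.
move=> dY; rewrite /betaHH /nabla_pull /nabla !chrE !dHHE// diff_jacobian.
have -> : 'D_(X x) (fun z => dHH a b h z (Y z)) x =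
    'D_(X x) Y x *m Phi x + Y x *m 'D_(X x) Phi x.
  have := is_derive_mulmx (differentiable_is_derive (X x) dY)
    (differentiable_is_derive (X x) Phi_differentiable) => /is_deriveE <-.
  by apply: near_eq_derive; apply: filterS (open_near Aopen Ax) => z /dHHE.
exact: cov_map_mx.
Qed.

(** The pull-back by f of the transverse metric of the target. *)
Definition pull_form z : 'M[R]_d := Phi z *m gram b (h z) *m (Phi z)^T.

Lemma inner_pull_form z u v :
  inner (pull_form z) u v = inner (gram b (h z)) (u *m Phi z) (v *m Phi z).
Proof.
exact: inner_pull.
Qed.

Let Gs : (gram b y)^T = gram b y := gram_sym F' g' (Aj Ax).

Lemma pull_form_sym : (pull_form x)^T = pull_form x.
Proof.
rewrite /pull_form; move: (Phi x) => P.
by rewrite !trmx_mul trmxK Gs mulmxA.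
Qed.

Let dG w : is_derive x w (gram b \o h) ('D_(w *m 'J h x) (gram b) y).
Proof.
have Gd := gram_differentiable F' g' (Aj Ax).
rewrite -deriveEjacobian; last exact: hd.
rewrite -derive_comp//; last exact: hd.
apply: differentiable_is_derive; apply: differentiable_comp => //; exact: hd.
Qed.

Lemma pull_form_differentiable : differentiable pull_form x.
Proof.
have dP := Phi_differentiable.
apply: differentiable_mulmx; last exact: differentiable_trmx.
apply: differentiable_mulmx => //.
apply: (@differentiable_comp _ _ _ _ h (gram b)); first exact: hd.
exact/gram_differentiable/Aj.
Qed.

Lemma covH_pull w : covH a x pull_form w =
  beta_mx w *m gram b y *m (Phi x)^T + Phi x *m gram b y *m (beta_mx w)^T.
Proof.
have dP := differentiable_is_derive w Phi_differentiable.
rewrite /covH /pull_form /beta_mx.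
rewrite (is_deriveE (is_derive_mulmx (is_derive_mulmx dP (dG w)) (is_derive_trmx dP))).
apply: cov_form_mx => //.
exact: (chr_metric_chart F' g' (w *m 'J h x) (Aj Ax)).
Qed.

(** The second derivatives of h and the Christoffel symbols of the source are
    symmetric; what remains lives on the target and depends on v and w through
    their images under df only. *)
Lemma beta_antisym v w : let p := w *m 'J h x in let q := v *m 'J h x in
  v *m beta_mx w - w *m beta_mx v =
  q *m 'D_p (piH b) y - p *m 'D_q (piH b) y
    + q *m piH b y *m chr_mx b y p - p *m piH b y *m chr_mx b y q.
Proof.
move=> p q; rewrite /beta_mx !derive_Phi -/p -/q /Phi.
have Hs := hessian_sym Aopen hsA v w Ax.
have Ct := chr_sym_chart F g w v (Ai Ax).
move: (piH b y) (chr_mx a x v) (chr_mx a x w) Ct => Q Cv Cw Ct.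
move: ('D_w J x) ('D_v J x) Hs => Jw Jv Hs.
rewrite !mulmxBr !mulmxDr !mulmxA -/p -/q Hs Ct.
move: (w *m Jv *m Q) (w *m Cv *m 'J h x *m Q) (q *m 'D_p _ _) (p *m 'D_q _ _)
  (q *m Q *m _) (p *m Q *m _) => r s t o z c.
by apply/rowP => n; rewrite !mxE; ring.
Qed.

Lemma inner_covH_pull w u v : inner (covH a x pull_form w) u v =
  inner (gram b y) (u *m beta_mx w) (v *m Phi x)
  + inner (gram b y) (u *m Phi x) (v *m beta_mx w).
Proof.
by rewrite covH_pull inner_add !inner_pull.
Qed.

End pullback.

(** * Horizontal frames *)

Section horizontal_frame.
Context {R : realType} {m k : nat} (a : geom R (m + k)) (x : 'rV[R]_(m + k))
  (eT : 'I_(m + k) -> 'rV[R]_(m + k)) (eH : 'I_m -> 'rV[R]_(m + k)).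
Local Notation G := (gram a x).
Context (Gsym : G^T = G) (Gpos : forall u, u != 0 -> 0 < inner G u u)
  (Vrank : \rank (vert a x) = k)
  (eHorth : forall i j, inner G (eH i) (eH j) = (i == j)%:R)
  (eHhor : forall i, (eH i <= hor a x)%MS)
  (eTexp : forall u, u = \sum_A inner G u (eT A) *: eT A).

(** The m vectors are independent and the horizontal space has dimension m. *)
Lemma hor_frame_sub : (hor a x <= \matrix_i eH i)%MS.
Proof.
set E := \matrix_i eH i.
have EG : E *m (G *m E^T) = 1%:M.
  apply/matrixP => i j; rewrite [RHS]mxE -eHorth /inner.
  have eM l : eH l = delta_mx 0 l *m E by rewrite -rowE rowK.
  have entry (K : 'M[R]_m) : K i j =
      ((delta_mx 0 i : 'rV_m) *m K *m (delta_mx j 0 : 'cV_m)) 0 0.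
    by rewrite -rowE -colE !mxE.
  by rewrite entry !eM trmx_mul trmx_delta !mulmxA.
have Efree : row_free E by apply/row_freeP; exists (G *m E^T).
have Ehor : (E <= hor a x)%MS by apply/row_subP => i; rewrite rowK.
rewrite -(geq_leqif (mxrank_leqif_sup Ehor)) (eqP Efree).
have := mxrank_disjoint_sum (vert_cap_hor Gpos).
have /eqP -> : row_full (vert a x + hor a x)%MS.
  by rewrite -sub1mx; exact: vert_add_hor.
by rewrite Vrank => h; have /addnI <- := etrans (addnC k m) h.
Qed.

Lemma sub_hor_frame_vert u : (u - \sum_i inner G u (eH i) *: eH i <= vert a x)%MS.
Proof.
set w := u - _.
have wE j : inner G w (eH j) = 0.
  rewrite innerDl innerNl inner_suml (bigD1 j)//= innerZl eHorth eqxx mulr1.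
  rewrite big1 ?addr0 ?subrr// => i ij.
  by rewrite innerZl eHorth (negbTE ij) mulr0.
have wQ : w *m piH a x = 0.
  apply: orth_hor_piH0 => // v vH.
  have /submxP[c ->] := submx_trans vH hor_frame_sub.
  rewrite mulmx_sum_row inner_sumr big1// => i _.
  by rewrite rowK innerZr wE mulr0.
by rewrite -[w]mulmx1 -(piVDpiH Gpos) mulmxDr wQ addr0 piV_sub.
Qed.

(** The trace of a form that vanishes on vertical second arguments may be taken
    over a horizontal frame: such an argument can be replaced by its horizontal
    part, and the two frames are then exchanged. *)
Lemma frame_trace (D : 'M[R]_(m + k)) :
  (forall u v, (v <= vert a x)%MS -> inner D u v = 0) ->
  \sum_A inner D (eT A) (eT A) = \sum_i inner D (eH i) (eH i).
Proof.
move=> Dv.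
have E A : inner D (eT A) (eT A) =
    \sum_i inner G (eH i) (eT A) * inner D (eT A) (eH i).
  have -> : inner D (eT A) (eT A) =
     inner D (eT A) (\sum_i inner G (eT A) (eH i) *: eH i).
    apply/eqP; rewrite -subr_eq0 -innerNr -innerDr; apply/eqP/Dv.
    exact: sub_hor_frame_vert.
  rewrite inner_sumr; apply: eq_bigr => i _.
  by rewrite innerZr (innerC _ _ Gsym).
under eq_bigr do rewrite E.
rewrite exchange_big; apply: eq_bigr => i _.
rewrite [in RHS](_ : inner D _ _ =
  inner D (\sum_A inner G (eH i) (eT A) *: eT A) (eH i)); last by rewrite -eTexp.
by rewrite inner_suml; apply: eq_bigr => A _; rewrite innerZl.
Qed.

End horizontal_frame.

(** * The divergence of the stress-energy tensor *)

Section transversal.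
Context {R : realType} {d d' k l : nat} {M : manifold R d} {N : manifold R d'}
  (F : foliation M k) (g : metric M) (F' : foliation N l) (g' : metric N)
  (f : M -> N) (i : chart M) (j : chart N) (A : set 'rV[R]_d) (x : 'rV[R]_d).
Context (fs : smooth_map f) (fol : foliated_map f F F')
  (Riem : riemannian_foliation F' g').
Context (Aopen : open A) (Aov : A `<=` overlap f i j) (Ax : A x).
Local Notation a := (local_geom F g i).
Local Notation b := (local_geom F' g' j).
Local Notation h := (rep f i j).
Local Notation y := (h x).
Local Notation Ph := (Phi F' g' f i j x).
Local Notation bet := (beta_mx F g F' g' f i j x).
Implicit Types (u v w : 'rV[R]_d).

Let yj : img j y.
Proof. by have [] := overlap_img (Aov Ax). Qed.

Let Gs : (gram b y)^T = gram b y := gram_sym F' g' yj.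

Lemma Ttens_horl p q : Ttens b y (p *m piH b y) q = Ttens b y p q.
Proof.
by rewrite /Ttens; have := piH_proj (gram_pos F' g' yj); move: (piH b y) => Q QQ;
  rewrite -(mulmxA p) QQ.
Qed.

Lemma Ttens_diag p : Ttens b y p p = 0.
Proof.
apply/rowP => c; rewrite [RHS]mxE; apply/eqP.
have /eqP := congr1 (fun v : 'rV_d' => v 0 c) (Ttens_skew yj Riem p p).
by rewrite [X in _ == X]mxE -addr_eq0 -mulr2n mulrn_eq0.
Qed.

(** The second term of [antisym_cov] contains T_xi xi with xi = phi v, which
    vanishes. *)
Lemma inner_beta_antisym v w :
  inner (gram b y) (v *m bet w - w *m bet v) (v *m Ph) =
  inner (gram b y) (v *m 'J h x *m piV b y) (Ttens b y (w *m Ph) (v *m Ph)).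
Proof.
rewrite (beta_antisym F g F' g' fs Aopen Aov Ax).
have vPh : v *m Ph *m piH b y = v *m Ph.
  by rewrite -mulmxA (Phi_hor F' g' Aov Ax).
rewrite (antisym_cov_chart yj _ _ vPh).
have TJ u q : Ttens b y (u *m 'J h x) q = Ttens b y (u *m Ph) q.
  by rewrite -Ttens_horl /Phi (mulmxA u).
rewrite !TJ.
by rewrite Ttens_diag inner0r subr0.
Qed.

End transversal.

Theorem corollary4p3 (R : realType) (m k n l : nat)
  (M : manifold R (m + k)) (F : foliation M k) (g : metric M)
  (N : manifold R (n + l)) (F' : foliation N l) (g' : metric N)
  (f : M -> N) :
  riemannian_foliation F g -> riemannian_foliation F' g' ->
  smooth_map f ->
  transversally_harmonic f m F g F' g' ->
  forall X : chart M -> 'rV[R]_(m + k) -> 'rV[R]_(m + k),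
  vector_field X ->
  forall (i : chart M) (j : chart N) (A : set 'rV[R]_(m + k))
    (eT : 'I_(m + k) -> 'rV[R]_(m + k) -> 'rV[R]_(m + k))
    (eH : 'I_m -> 'rV[R]_(m + k) -> 'rV[R]_(m + k)),
  open A -> A `<=` overlap f i j ->
  orthonormal_frame (local_geom F g i) A eT ->
  horizontal_frame (local_geom F g i) A eH ->
  forall x, A x ->
  div_stressHH (local_geom F g i) (local_geom F' g' j) (rep f i j)
    eT eH (X i) x = 0.
Proof.
move=> _ Riem fs [harm fol] X [Xs _] i j A eT eH Aopen Aov eTf eHf x Ax.
have tension0 := harm i j A eT eH Aopen Aov eTf eHf x Ax.
have [eTs eTo] := eTf; have [[eHs eHo] eHh] := eHf.
set a := local_geom F g i in eTo eHo eHh tension0 *.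
set b := local_geom F' g' j in tension0 *.
set h := rep f i j in tension0 *.
have Ai z : A z -> img i z by move=> /Aov/overlap_img[].
have Aj z : A z -> img j (h z) by move=> /Aov/overlap_img[].
have Gs z : A z -> (gram a z)^T = gram a z.
  by move=> Az; exact: gram_sym (Ai z Az).
have Gsn : \near x, (gram a x)^T = gram a x by apply: filterS (open_near Aopen Ax).
have Gp z : A z -> forall u, u != 0 -> 0 < inner (gram a z) u u.
  by move=> Az; exact: gram_pos (Ai z Az).
have eTd B : differentiable (eT B) x by exact: smooth_on_differentiable (eTs B) Ax.
have Xd : differentiable (X i) x by exact: smooth_on_differentiable (Xs i) (Ai x Ax).
have eTn z : A z -> \near z, forall B C, inner (gram a z) (eT B z) (eT C z) = (B == C)%:R.
  by move=> Az; apply: filterS (open_near Aopen Az) => t; exact: eTo.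
(* Needed at all points near x, since the norm of phi is differentiated. *)
have trace z D : A z ->
    (forall u v, (v <= vert a z)%MS -> inner D u v = 0) ->
    \sum_B inner D (eT B z) (eT B z) = \sum_r inner D (eH r z) (eH r z).
  move=> Az; apply: (@frame_trace _ _ _ a z) => //.
  - exact: Gs.
  - exact: Gp.
  - exact: dist_rank (Ai z Az).
  - exact: eHo.
  - by move=> r; exact: eHh.
  - by move=> u; exact: (@frame_expand _ _ a z eT (eTn z Az) u).
pose H := pull_form F' g' f i j.
pose Ph := Phi F' g' f i j.
have phiE z u : A z -> dHH a b h z u = u *m Ph z.
  by move=> Az; exact: (dHHE g g' fol Aov u Az).
have Hvert z u v : A z -> (v <= vert a z)%MS -> inner (H z) u v = 0.
  move=> Az vV; rewrite inner_pull_form.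
  by rewrite (vert_Phi0 g' fol Aov Az vV) inner0r.
have stressE Y Z z : A z -> stressHH a b h eH Y Z z = stress a H eT Y Z z.
  move=> Az; rewrite /stressHH /stress /norm2_dHH (trace z (H z) Az).
    rewrite !phiE// -inner_pull_form; congr (_ * _ * _ - _).
    by apply: eq_bigr => r _; rewrite phiE// -inner_pull_form.
  by move=> u v; exact: Hvert.
have divE : div_stressHH a b h eT eH (X i) x =
    2^-1 * \sum_B inner (covH a x H (X i x)) (eT B x) (eT B x)
    - \sum_B inner (covH a x H (eT B x)) (eT B x) (X i x).
  rewrite -(div_stress Gsn (gram_differentiable F g (Ai x Ax))
    (gram_unit F g (Ai x Ax)) (pull_form_differentiable F' g' fs Aopen Aov Ax)
    (pull_form_sym F' g' Aov Ax) eTd (eTn x Ax) Xd).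
  apply: eq_bigr => B _; rewrite /nabla_stressHH !stressE//.
  congr (_ - _ - _).
  by apply: near_eq_derive; apply: filterS (open_near Aopen Ax) => z; exact: stressE.
pose G' := gram b (h x); pose e B := eT B x; pose Y := X i x.
pose bet := beta_mx F g F' g' f i j x; pose P := Ph x.
have G's : G'^T = G' by exact: (gram_sym F' g' (Aj x Ax)).
have covHE u v w : inner (covH a x H u) v w =
    inner G' (v *m bet u) (w *m P) + inner G' (v *m P) (w *m bet u).
  exact: (inner_covH_pull F g F' g' fs Aopen Aov Ax).
pose J := 'J h x; pose T := Ttens b (h x).
(* The divergence, with the antisymmetric part of beta replaced by T. *)
have reduce : div_stressHH a b h eT eH (X i) x =
    \sum_B inner G' (e B *m J *m piV b (h x)) (T (Y *m P) (e B *m P))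
    - inner G' (\sum_B e B *m bet (e B)) (Y *m P).
  rewrite divE mulr_sumr inner_suml -!sumrB; apply: eq_bigr => B _.
  rewrite -/(e B) -/Y !covHE.
  rewrite -(inner_beta_antisym F g fs Riem Aopen Aov Ax (e B) Y).
  rewrite innerDl innerNl -/bet -/P -/G'.
  rewrite (innerC (e B *m P) _ G's) (innerC (e B *m P) _ G's).
  move: (inner G' _ _) (inner G' _ _) (inner G' _ _) => p q r.
  by field.
(* The form (u, v) |-> <psi u, T_(phi Y) (phi v)> vanishes on vertical v. *)
have crossE u v : inner (J *m piV b (h x) *m G' *m
      (P *m Ttens_mx F' g' j (h x) (Y *m P))^T) u v =
    inner G' (u *m J *m piV b (h x)) (T (Y *m P) (v *m P)).
  rewrite /T (Ttens_mxE F' g' (Aj x Ax)) inner_pull.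
  by rewrite (mulmxA u J) (mulmxA v P).
have cross : \sum_B inner G' (e B *m J *m piV b (h x)) (T (Y *m P) (e B *m P)) =
    - \sum_r inner G' (Tadj b (h x) (dHH a b h x (eH r x))
        (dHV a b h x (eH r x))) (Y *m P).
  under eq_bigr do rewrite -crossE.
  rewrite (trace x _ Ax) => [|u v vV]; last first.
    rewrite crossE (_ : v *m P = 0) ?/T ?(Ttens_mxE F' g' (Aj x Ax)) ?mul0mx ?inner0r//.
    exact: (vert_Phi0 g' fol Aov Ax vV).
  rewrite -sumrN; apply: eq_bigr => r _.
  rewrite crossE phiE// /dHV diff_jacobian (piH_id (Gp x Ax) (eHh x Ax r)).
  rewrite (Tadj_inner F' g' (Aj x Ax)) /T (Ttens_skew (Aj x Ax) Riem).
  by rewrite innerNr opprK.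
have YP : Y *m P *m piH b (h x) = Y *m P.
  by rewrite -mulmxA (Phi_hor F' g' Aov Ax).
(* W is vertical, phi Y is horizontal. *)
have W0 u v : inner G' (Wtens b (h x) u v) (Y *m P) = 0.
  rewrite -YP -(inner_piH (gram_sym F' g' (Aj x Ax)) (gram_pos F' g' (Aj x Ax))).
  by rewrite (Wtens_vert F' g' (Aj x Ax)) inner0l.
have := congr1 (fun v => inner G' v (Y *m P)) tension0.
rewrite inner0l /tensionHH innerDl reduce cross.
rewrite (eq_bigr (fun B => e B *m bet (e B))) => [|B _]; last first.
  exact: (betaHHE g g' fs fol Aopen Aov Ax (eT B) (eTd B)).
rewrite [X in _ + X]inner_suml.
under [X in _ + X]eq_bigr do rewrite innerDl W0 addr0.
by move/eqP; rewrite addr_eq0 => /eqP ->; rewrite opprK addNr.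
Qed.
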